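(* Let $\Phi:\mathbb{U}\to\mathbb{C}$ be a biholomorphic function onto its image with $\Phi(0)=1$, $\operatorname{Re}\Phi(z)>0$ on $\mathbb{U}$, $\Phi'(0)>0$, $\Phi''(0)\in\mathbb{R}$, and suppose that $$2\Phi'(0)-2(\Phi'(0))^2\le\Phi''(0)\le 6(\Phi'(0))^2-2\Phi'(0).$$ Let $g(z)=z+b_2z^2+b_3z^3+\cdots$ be holomorphic in $\mathbb{U}$ with $g/g'\in\mathcal{M}_\Phi$. Then $$|\det T_{3,1}(g)|\le 1+2(\Phi'(0))^2+\frac{(\Phi'(0))^2}{4}\left(3\Phi'(0)-\frac{\Phi''(0)}{2\Phi'(0)}\right)\left(\frac{\Phi''(0)}{2\Phi'(0)}+\Phi'(0)\right).$$ The bound is sharp, i.e. for each such $\Phi$ equality holds for some such $g$.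
   Context: $\mathbb{U}=\{z\in\mathbb{C}:|z|<1\}$. For $g(z)=z+\sum_{n\ge2}b_nz^n$, $\det T_{3,1}(g)=2b_2^2b_3-2b_2^2-b_3^2+1$ (the determinant of the $3\times3$ Toeplitz matrix with rows $(1,b_2,b_3)$, $(b_2,1,b_2)$, $(b_3,b_2,1)$). In one variable, $\mathcal{M}_\Phi$ is the class of holomorphic $p:\mathbb{U}\to\mathbb{C}$ with $p(0)=0$, $p'(0)=1$ and $z/p(z)\in\Phi(\mathbb{U})$ for all $z\in\mathbb{U}$ (the quotient taking the value $1$ at $z=0$). Thus $g/g'\in\mathcal{M}_\Phi$ means $zg'(z)/g(z)\in\Phi(\mathbb{U})$ for all $z\in\mathbb{U}$. *)

(* Defs.v *)
(* Stdlib reals with Coquelicot's complex numbers. *)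
From Stdlib Require Import Reals.
From Coquelicot Require Import Coquelicot.

Open Scope C_scope.

Definition unit_disc (z : C) : Prop := (Cmod z < 1)%R.

Definition image (f : C -> C) (D : C -> Prop) (w : C) : Prop :=
  exists z : C, D z /\ f z = w.

(* Complex differentiability at every point of D, which is meant to be open.
   Functions are total on C; their values off D play no role. *)
Definition holomorphic_on (D : C -> Prop) (f : C -> C) : Prop :=
  forall z : C, D z -> ex_derive (K := C_AbsRing) (V := C_NormedModule) f z.

Definition biholomorphic_onto_image (D : C -> Prop) (f : C -> C) : Prop :=
  holomorphic_on D f /\
  open (image f D) /\
  exists h : C -> C,
    holomorphic_on (image f D) h /\ (forall z : C, D z -> h (f z) = z).

(* The quotient z / p(z), with the value 1 at z = 0. *)
Definition id_over (p : C -> C) (z : C) : C :=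
  if Ceq_dec z 0 then 1 else z / p z.

(* The condition [p z <> 0] says that z / p(z) is defined away from 0; it is
   spelled out because division is total. *)
Definition class_M (Phi p : C -> C) : Prop :=
  holomorphic_on unit_disc p /\
  p 0 = 0 /\
  C_derive p 0 = 1 /\
  (forall z : C, unit_disc z -> z <> 0 -> p z <> 0) /\
  (forall z : C, unit_disc z -> image Phi unit_disc (id_over p z)).

(* g / g' belongs to M_Phi; the first clause says that the quotient is
   defined on the whole disc. *)
Definition quotient_in_M (Phi g : C -> C) : Prop :=
  (forall z : C, unit_disc z -> C_derive g z <> 0) /\
  class_M Phi (fun z : C => g z / C_derive g z).

(* g is holomorphic on the disc and g(z) = z + b_2 z^2 + b_3 z^3 + ... there. *)
Definition normalized_expansion (g : C -> C) (b : nat -> C) : Prop :=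
  holomorphic_on unit_disc g /\
  b 0%nat = 0 /\
  b 1%nat = 1 /\
  (forall z : C, unit_disc z ->
     is_pseries (K := C_AbsRing) (V := C_NormedModule) b z (g z)).

(* T_{q,n}: the (i,j) entry is b_{n+|i-j|}. With truncated subtraction,
   |i-j| = (i-j) + (j-i). *)
Definition Toeplitz (q n : nat) (b : nat -> C) : @matrix C q q :=
  mk_matrix q q (fun i j : nat => b (n + ((i - j) + (j - i)))%nat).

Definition det3 (M : @matrix C 3 3) : C :=
  let m := coeff_mat (RtoC 0) M in
  m 0%nat 0%nat *
    (m 1%nat 1%nat * m 2%nat 2%nat - m 1%nat 2%nat * m 2%nat 1%nat)
  - m 0%nat 1%nat *
    (m 1%nat 0%nat * m 2%nat 2%nat - m 1%nat 2%nat * m 2%nat 0%nat)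
  + m 0%nat 2%nat *
    (m 1%nat 0%nat * m 2%nat 1%nat - m 1%nat 1%nat * m 2%nat 0%nat).

Lemma det3_Toeplitz (b : nat -> C) : b 1%nat = 1 ->
  det3 (Toeplitz 3 1 b) =
  2 * b 2%nat ^ 2 * b 3%nat - 2 * b 2%nat ^ 2 - b 3%nat ^ 2 + 1.
Proof.
intros b1; unfold det3, Toeplitz; cbv zeta.
rewrite !coeff_mat_bij by repeat constructor.
simpl; rewrite b1; ring.
Qed.

(* Main.v *)
Require Import Defs.
From Stdlib Require Import Reals Arith Lra Lia ClassicalEpsilon.
From Coquelicot Require Import Coquelicot.

(* Membership of g/g' in M_Phi means z g' = g (Phi o w) for a holomorphic self-map
   w = c_1 z + c_2 z^2 + ... of the disc, and Schwarz's lemma gives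
   |c_2| + |c_1|^2 <= 1. With lambda = B2/(2 B1) + B1 and mu = 3 B1 - B2/(2 B1),
   comparing coefficients yields b_2 = B1 c_1, b_3 = (B1/2) (c_2 + lambda c_1^2) and
   2 b_2^2 - b_3 = (B1/2) (mu c_1^2 - c_2). The two hypotheses on B2 say lambda >= 1 and
   mu >= 1, so that |b_3| <= (B1/2) lambda and |2 b_2^2 - b_3| <= (B1/2) mu; the determinant
   is 1 - 2 b_2^2 + b_3 (2 b_2^2 - b_3). Equality holds for w(z) = i z.

   Power series of holomorphic functions come from Goursat's theorem: the difference
   quotient of f at z has a primitive on the disc, so its integral over |s| = r vanishes,
   and expanding s/(s - z) geometrically gives the Taylor series. *)

Open Scope R_scope.

(** * Complex derivatives and the exponential *)

(** Before power series are available, the difference quotient at [z] is known to be holomorphic off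
    [z] but merely continuous at [z]. Goursat's theorem must therefore tolerate one exceptional
    point. Removable singularities come afterwards, out of the Taylor series; they are what makes
    [w], the inverse of [Phi] applied to the quotient [z g' / g], holomorphic at 0.

    The inequality for [c_1] and [c_2] is obtained by averaging, without a maximum principle: [w] is
    integrated over circles against the square of a trigonometric polynomial with a free parameter,
    which is then adapted to the arguments of the coefficients.

    For [w(z) = i z] one has b_2^2 = -B1^2, b_3 = -(B1/2) lambda and 2 b_2^2 - b_3 = -(B1/2) mu. All
    three terms 1, -2 b_2^2 and b_3 (2 b_2^2 - b_3) of the determinant are then positive, so the
    triangle inequality loses nothing. The corresponding [g] is [z] times the exponential of a
    primitive of (Phi(i z) - 1)/z, again a difference quotient. *)

Lemma Cmod_triangle3 (x y z : C) : Cmod (x + y + z) <= Cmod x + Cmod y + Cmod z.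
Proof.
apply Rle_trans with (1 := Cmod_triangle _ _).
apply Rplus_le_compat_r, Cmod_triangle.
Qed.

Lemma Cmod_minus_le (x y : C) : Cmod (x - y) <= Cmod x + Cmod y.
Proof.
apply Rle_trans with (1 := Cmod_triangle _ _).
rewrite Cmod_opp; apply Rle_refl.
Qed.

Lemma Cmod_minus_ge (x y : C) : Cmod x - Cmod y <= Cmod (x - y).
Proof.
assert (H := Cmod_triangle (x - y) y).
replace (x - y + y)%C with x in H by ring; lra.
Qed.

Lemma Cmod_minus_sym (x y : C) : Cmod (x - y) = Cmod (y - x).
Proof. rewrite <- Cmod_opp; f_equal; ring. Qed.

(** With increments instead of quotients, [h = 0] needs no exception, and each rule of calculus
    becomes an algebraic identity followed by a norm estimate. *)
Definition cderiv (f : C -> C) (z l : C) : Prop :=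
  forall eps, 0 < eps -> exists del, 0 < del /\ forall h : C, Cmod h < del ->
    Cmod (f (z + h) - f z - l * h)%C <= eps * Cmod h.

Definition ccont (f : C -> C) (z : C) : Prop :=
  forall eps, 0 < eps -> exists del, 0 < del /\ forall h : C, Cmod h < del ->
    Cmod (f (z + h) - f z)%C < eps.

Lemma cderiv_is_derive (f : C -> C) (z l : C) :
  cderiv f z l <-> is_derive (K := C_AbsRing) (V := C_NormedModule) f z l.
Proof.
split.
- intros H; split.
  + apply is_linear_scal_l.
  + intros x Hx.
    assert (Ex : z = x).
    { apply (is_filter_lim_locally_unique (K := C_AbsRing)
        (V := AbsRing_NormedModule C_AbsRing) _ _ Hx). }
    subst x; intros eps.
    destruct (H eps (cond_pos eps)) as [d [Hd Hh]].
    exists (mkposreal d Hd).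
    assert (G : forall y : C, Cmod (y - z) < d ->
      Cmod (f y - f z - (y - z) * l)%C <= eps * Cmod (y - z)).
    { intros y Hy; specialize (Hh (y - z)%C Hy).
      replace (z + (y - z))%C with y in Hh by ring.
      now rewrite Cmult_comm. }
    exact G.
- intros [_ H] eps Heps.
  destruct (H z (fun P HP => HP) (mkposreal eps Heps)) as [d Hd].
  exists d; split; [apply cond_pos|]; intros h Hh.
  assert (Eh : ((z + h) - z = h)%C) by ring.
  assert (B : ball (M := AbsRing_UniformSpace C_AbsRing) z d (z + h)%C).
  { change (Cmod ((z + h) - z)%C < d); rewrite Eh; exact Hh. }
  specialize (Hd _ B).
  change (Cmod (f (z + h)%C - f z - ((z + h) - z) * l)%C
          <= eps * Cmod ((z + h) - z)%C) in Hd.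
  rewrite Eh in Hd; rewrite (Cmult_comm l h); exact Hd.
Qed.

Lemma cderiv_C_derive (f : C -> C) (z l : C) : cderiv f z l -> C_derive f z = l.
Proof. intros H; apply is_C_derive_unique, cderiv_is_derive, H. Qed.

Lemma cderiv_ex (f : C -> C) (z l : C) : cderiv f z l ->
  ex_derive (K := C_AbsRing) (V := C_NormedModule) f z.
Proof. intros H; exists l; apply cderiv_is_derive, H. Qed.

Lemma holomorphic_cderiv (D : C -> Prop) (f : C -> C) (z : C) :
  holomorphic_on D f -> D z -> cderiv f z (C_derive f z).
Proof.
intros H Dz; apply cderiv_is_derive, C_derive_correct; [exact z | now apply H].
Qed.

Lemma cderiv_eq (f : C -> C) (z l m : C) : cderiv f z l -> l = m -> cderiv f z m.
Proof. intros H <-; exact H. Qed.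

Lemma cderiv_ext_near (f g : C -> C) (z l : C) (d : R) : 0 < d ->
  (forall h : C, Cmod h < d -> f (z + h)%C = g (z + h)%C) ->
  cderiv f z l -> cderiv g z l.
Proof.
intros Hd E H eps Heps; destruct (H eps Heps) as [d' [Hd' H']].
exists (Rmin d d'); split; [now apply Rmin_pos|]; intros h Hh.
assert (Cmod h < d) by (apply Rlt_le_trans with (1 := Hh), Rmin_l).
assert (Cmod h < d') by (apply Rlt_le_trans with (1 := Hh), Rmin_r).
replace (g z) with (f z).
2: { rewrite <- (Cplus_0_r z); apply E; rewrite Cmod_0; exact Hd. }
rewrite <- E by assumption; now apply H'.
Qed.

(** The rules for products, composites and inverses produce errors with clumsy constants [K];
    rescaling [e] once here spares each of them an exact [eps]. The restriction [e <= 1] allows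
    products of small quantities to be absorbed. *)
Lemma cderiv_of_bound (f : C -> C) (z l : C) (K : R) : 0 <= K ->
  (forall e, 0 < e <= 1 -> exists del, 0 < del /\ forall h : C, Cmod h < del ->
     Cmod (f (z + h) - f z - l * h)%C <= K * e * Cmod h) ->
  cderiv f z l.
Proof.
intros HK H eps Heps.
assert (Hq : 0 < eps / (K + 1)) by (apply Rdiv_lt_0_compat; lra).
destruct (H (Rmin 1 (eps / (K + 1)))) as [d [Hd Hh]].
{ split; [apply Rmin_pos; lra | apply Rmin_l]. }
exists d; split; [exact Hd|]; intros h Hm.
apply Rle_trans with (1 := Hh h Hm).
apply Rmult_le_compat_r; [apply Cmod_ge_0|].
apply Rle_trans with (K * (eps / (K + 1))).
{ apply Rmult_le_compat_l; [exact HK | apply Rmin_r]. }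
replace (K * (eps / (K + 1))) with (eps * (K / (K + 1))) by (field; lra).
rewrite <- (Rmult_1_r eps) at 2; apply Rmult_le_compat_l; [lra|].
apply Rle_div_l; lra.
Qed.

Lemma cderiv_ccont (f : C -> C) (z l : C) : cderiv f z l -> ccont f z.
Proof.
intros H eps Heps; destruct (H 1 Rlt_0_1) as [d [Hd Hh]].
assert (Hl := Cmod_ge_0 l).
assert (Hq : 0 < eps / (Cmod l + 2)) by (apply Rdiv_lt_0_compat; lra).
exists (Rmin d (eps / (Cmod l + 2))); split; [now apply Rmin_pos|]; intros h Hm.
assert (H1 : Cmod h < d) by (apply Rlt_le_trans with (1 := Hm), Rmin_l).
assert (H2 : Cmod h < eps / (Cmod l + 2))
  by (apply Rlt_le_trans with (1 := Hm), Rmin_r).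
specialize (Hh h H1).
replace (f (z + h) - f z)%C with ((f (z + h) - f z - l * h) + l * h)%C by ring.
apply Rle_lt_trans with (1 := Cmod_triangle _ _); rewrite Cmod_mult.
assert (Cmod h * (Cmod l + 2) < eps) by (apply Rlt_div_r; lra).
assert (Hp := Cmod_ge_0 h); nra.
Qed.

Lemma cderiv_const (c z : C) : cderiv (fun _ => c) z 0.
Proof.
intros eps Heps; exists 1; split; [lra|]; intros h _.
replace (c - c - 0 * h)%C with (RtoC 0) by ring; rewrite Cmod_0.
assert (Hp := Cmod_ge_0 h); nra.
Qed.

Lemma cderiv_id (z : C) : cderiv (fun w => w) z 1.
Proof.
intros eps Heps; exists 1; split; [lra|]; intros h _.
replace (z + h - z - 1 * h)%C with (RtoC 0) by ring; rewrite Cmod_0.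
assert (Hp := Cmod_ge_0 h); nra.
Qed.

Lemma cderiv_plus (f g : C -> C) (z l m : C) : cderiv f z l -> cderiv g z m ->
  cderiv (fun w => f w + g w)%C z (l + m).
Proof.
intros Hf Hg; apply cderiv_of_bound with 2; [lra|]; intros e He.
destruct (Hf e) as [d1 [Hd1 H1]]; [lra|].
destruct (Hg e) as [d2 [Hd2 H2]]; [lra|].
exists (Rmin d1 d2); split; [now apply Rmin_pos|]; intros h Hm.
specialize (H1 h (Rlt_le_trans _ _ _ Hm (Rmin_l _ _))).
specialize (H2 h (Rlt_le_trans _ _ _ Hm (Rmin_r _ _))).
replace (f (z + h) + g (z + h) - (f z + g z) - (l + m) * h)%C
  with ((f (z + h) - f z - l * h) + (g (z + h) - g z - m * h))%C by ring.
apply Rle_trans with (1 := Cmod_triangle _ _); lra.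
Qed.

Lemma cderiv_mult (f g : C -> C) (z l m : C) : cderiv f z l -> cderiv g z m ->
  cderiv (fun w => f w * g w)%C z (l * g z + f z * m).
Proof.
intros Hf Hg.
assert (Pf := Cmod_ge_0 (f z)); assert (Pg := Cmod_ge_0 (g z)).
assert (Pl := Cmod_ge_0 l); assert (Pm := Cmod_ge_0 m).
apply cderiv_of_bound
  with (Cmod (g z) + Cmod m + 1 + (Cmod (f z) + Cmod l) + Cmod l * Cmod m).
{ assert (0 <= Cmod l * Cmod m) by now apply Rmult_le_pos. lra. }
intros e He.
destruct (Hf e) as [d1 [Hd1 H1]]; [lra|].
destruct (Hg e) as [d2 [Hd2 H2]]; [lra|].
(* Requiring [Cmod h < e] makes the quadratic term [l * m * h * h] an error of order
   [e * Cmod h]. *)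
exists (Rmin e (Rmin d1 d2)); split; [repeat apply Rmin_pos; lra|]; intros h Hm.
assert (M0 : Cmod h < e) by (apply Rlt_le_trans with (1 := Hm), Rmin_l).
assert (M1 : Cmod h < d1).
{ apply Rlt_le_trans with (1 := Hm), Rle_trans with (1 := Rmin_r _ _), Rmin_l. }
assert (M2 : Cmod h < d2).
{ apply Rlt_le_trans with (1 := Hm), Rle_trans with (1 := Rmin_r _ _), Rmin_r. }
specialize (H1 h M1); specialize (H2 h M2).
set (a := (f (z + h) - f z - l * h)%C) in *.
set (b := (g (z + h) - g z - m * h)%C) in *.
replace (f (z + h) * g (z + h) - f z * g z - (l * g z + f z * m) * h)%C
  with (a * (g z + m * h + b) + (f z + l * h) * b + l * m * h * h)%C
  by (unfold a, b; ring).
assert (Ph := Cmod_ge_0 h); assert (Pb := Cmod_ge_0 b).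
assert (Hb : Cmod (g z + m * h + b)%C <= Cmod (g z) + Cmod m + 1).
{ apply Rle_trans with (1 := Cmod_triangle3 _ _ _); rewrite Cmod_mult; nra. }
assert (Hc : Cmod (f z + l * h)%C <= Cmod (f z) + Cmod l).
{ apply Rle_trans with (1 := Cmod_triangle _ _); rewrite Cmod_mult; nra. }
apply Rle_trans with (1 := Cmod_triangle3 _ _ _); rewrite !Cmod_mult.
assert (X1 : Cmod a * Cmod (g z + m * h + b)%C
   <= (e * Cmod h) * (Cmod (g z) + Cmod m + 1)).
{ apply Rmult_le_compat; auto using Cmod_ge_0. }
assert (X2 : Cmod (f z + l * h)%C * Cmod b
   <= (Cmod (f z) + Cmod l) * (e * Cmod h)).
{ apply Rmult_le_compat; auto using Cmod_ge_0. }
assert (X3 : Cmod l * Cmod m * Cmod h * Cmod h <= Cmod l * Cmod m * e * Cmod h).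
{ apply Rmult_le_compat_r; [exact Ph|]; apply Rmult_le_compat_l; [|lra].
  now apply Rmult_le_pos. }
lra.
Qed.

Lemma cderiv_comp (f g : C -> C) (z l m : C) : cderiv f (g z) l ->
  cderiv g z m -> cderiv (fun w => f (g w)) z (l * m).
Proof.
intros Hf Hg.
assert (Pl := Cmod_ge_0 l); assert (Pm := Cmod_ge_0 m).
apply cderiv_of_bound with (Cmod m + 1 + Cmod l); [lra|]; intros e He.
destruct (Hf e) as [d1 [Hd1 H1]]; [lra|].
destruct (Hg e) as [d2 [Hd2 H2]]; [lra|].
assert (Hq : 0 < d1 / (Cmod m + 1)) by (apply Rdiv_lt_0_compat; lra).
exists (Rmin (d1 / (Cmod m + 1)) d2); split; [now apply Rmin_pos|]; intros h Hm.
assert (M1 : Cmod h < d1 / (Cmod m + 1))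
  by (apply Rlt_le_trans with (1 := Hm), Rmin_l).
apply Rlt_div_r in M1; [|lra].
specialize (H2 h (Rlt_le_trans _ _ _ Hm (Rmin_r _ _))).
assert (Ph := Cmod_ge_0 h).
set (k := (g (z + h) - g z)%C) in *.
assert (Hk : Cmod k <= (Cmod m + 1) * Cmod h).
{ replace k with ((k - m * h) + m * h)%C by ring.
  apply Rle_trans with (1 := Cmod_triangle _ _); rewrite Cmod_mult; nra. }
assert (H1' := H1 k ltac:(lra)).
replace (g z + k)%C with (g (z + h)%C) in H1' by (unfold k; ring).
replace (f (g (z + h)) - f (g z) - l * m * h)%C
  with ((f (g (z + h)) - f (g z) - l * k) + l * (k - m * h))%C by ring.
apply Rle_trans with (1 := Cmod_triangle _ _); rewrite Cmod_mult.
assert (e * Cmod k <= e * ((Cmod m + 1) * Cmod h))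
  by (apply Rmult_le_compat_l; lra).
assert (Cmod l * Cmod (k - m * h)%C <= Cmod l * (e * Cmod h))
  by (apply Rmult_le_compat_l; lra).
lra.
Qed.

Lemma cderiv_inv (z : C) : z <> 0 -> cderiv (fun w => / w)%C z (- / (z * z))%C.
Proof.
intros Hz; assert (Pz := proj1 (Cmod_gt_0 z) Hz).
apply cderiv_of_bound with (2 / (Cmod z * Cmod z * Cmod z)).
{ apply Rlt_le, Rdiv_lt_0_compat; [lra|]; repeat apply Rmult_lt_0_compat; lra. }
intros e He; exists (Rmin e (Cmod z / 2)); split; [apply Rmin_pos; lra|].
intros h Hm.
assert (M0 : Cmod h < e) by (apply Rlt_le_trans with (1 := Hm), Rmin_l).
assert (M1 : Cmod h < Cmod z / 2) by (apply Rlt_le_trans with (1 := Hm), Rmin_r).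
assert (Q : Cmod z / 2 <= Cmod (z + h)%C).
{ assert (X := Cmod_minus_ge z (- h)%C); rewrite Cmod_opp in X.
  replace (z - - h)%C with (z + h)%C in X by ring; lra. }
assert (Hn : (z + h)%C <> 0) by (apply Cmod_gt_0; lra).
replace (/ (z + h) - / z - - / (z * z) * h)%C
  with (h * h * / (z * z * (z + h)))%C by (field; auto).
assert (Hzz : (z * z * (z + h))%C <> 0) by (repeat apply Cmult_neq_0; auto).
rewrite !Cmod_mult, Cmod_inv, !Cmod_mult by exact Hzz.
assert (Ph := Cmod_ge_0 h).
apply Rle_trans with (e * Cmod h * / (Cmod z * Cmod z * (Cmod z / 2))).
2: { right; field; lra. }
apply Rmult_le_compat.
- now apply Rmult_le_pos.
- apply Rlt_le, Rinv_0_lt_compat; repeat apply Rmult_lt_0_compat; lra.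
- apply Rmult_le_compat_r; lra.
- apply Rinv_le_contravar; [repeat apply Rmult_lt_0_compat; lra|].
  apply Rmult_le_compat_l; [nra|exact Q].
Qed.

Lemma cderiv_scal (c : C) (f : C -> C) (z l : C) : cderiv f z l ->
  cderiv (fun w => c * f w)%C z (c * l).
Proof.
intros H; replace (c * l)%C with (0 * f z + c * l)%C by ring.
apply (cderiv_mult (fun _ => c) f); [apply cderiv_const | exact H].
Qed.

Lemma cderiv_minus (f g : C -> C) (z l m : C) : cderiv f z l -> cderiv g z m ->
  cderiv (fun w => f w - g w)%C z (l - m).
Proof.
intros Hf Hg; apply cderiv_ext_near with (fun w => f w + (- (1)) * g w)%C 1;
  [lra | intros; ring |].
replace (l - m)%C with (l + - (1) * m)%C by ring.
apply cderiv_plus; [exact Hf | now apply cderiv_scal].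
Qed.

Lemma cderiv_div (f g : C -> C) (z l m : C) : g z <> 0 -> cderiv f z l ->
  cderiv g z m ->
  cderiv (fun w => f w / g w)%C z (l * / g z + f z * (- / (g z * g z) * m)).
Proof.
intros Hz Hf Hg; apply (cderiv_mult f (fun w => / g w)%C); [exact Hf|].
apply (cderiv_comp (fun w => / w)%C g); [now apply cderiv_inv | exact Hg].
Qed.

Lemma cderiv_affine (a d z : C) : cderiv (fun t => a + t * d)%C z d.
Proof.
eapply cderiv_eq.
- apply cderiv_plus; [apply cderiv_const|].
  apply (cderiv_mult (fun t => t) (fun _ => d)); [apply cderiv_id | apply cderiv_const].
- ring.
Qed.

Lemma ccont_comp (f g : C -> C) (z : C) :
  ccont f (g z) -> ccont g z -> ccont (fun w => f (g w)) z.
Proof.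
intros Hf Hg eps Heps; destruct (Hf eps Heps) as [d [Hd H1]].
destruct (Hg d Hd) as [d' [Hd' H2]].
exists d'; split; [exact Hd'|]; intros h Hh.
replace (g (z + h)%C) with (g z + (g (z + h) - g z))%C by ring.
apply H1, H2, Hh.
Qed.

Lemma ccont_plus (f g : C -> C) (z : C) :
  ccont f z -> ccont g z -> ccont (fun w => f w + g w)%C z.
Proof.
intros Hf Hg eps Heps.
destruct (Hf (eps / 2)) as [d1 [Hd1 H1]]; [lra|].
destruct (Hg (eps / 2)) as [d2 [Hd2 H2]]; [lra|].
exists (Rmin d1 d2); split; [now apply Rmin_pos|]; intros h Hm.
specialize (H1 h (Rlt_le_trans _ _ _ Hm (Rmin_l _ _))).
specialize (H2 h (Rlt_le_trans _ _ _ Hm (Rmin_r _ _))).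
replace (f (z + h) + g (z + h) - (f z + g z))%C
  with ((f (z + h) - f z) + (g (z + h) - g z))%C by ring.
apply Rle_lt_trans with (1 := Cmod_triangle _ _); lra.
Qed.

Lemma ccont_mult (f g : C -> C) (z : C) :
  ccont f z -> ccont g z -> ccont (fun w => f w * g w)%C z.
Proof.
intros Hf Hg eps Heps.
assert (Pf := Cmod_ge_0 (f z)); assert (Pg := Cmod_ge_0 (g z)).
set (K := Cmod (f z) + Cmod (g z) + 1).
set (e := Rmin 1 (eps / K)).
assert (HK : 0 < eps / K) by (apply Rdiv_lt_0_compat; unfold K; lra).
assert (He : 0 < e) by (apply Rmin_pos; lra).
assert (He1 : e <= 1) by apply Rmin_l.
assert (He2 : e * K <= eps).
{ apply Rle_div_r; [unfold K; lra | apply Rmin_r]. }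
destruct (Hf e He) as [d1 [Hd1 H1]]; destruct (Hg e He) as [d2 [Hd2 H2]].
exists (Rmin d1 d2); split; [now apply Rmin_pos|]; intros h Hm.
specialize (H1 h (Rlt_le_trans _ _ _ Hm (Rmin_l _ _))).
specialize (H2 h (Rlt_le_trans _ _ _ Hm (Rmin_r _ _))).
set (a := (f (z + h) - f z)%C) in *; set (b := (g (z + h) - g z)%C) in *.
replace (f (z + h) * g (z + h) - f z * g z)%C
  with (a * g z + f z * b + a * b)%C by (unfold a, b; ring).
apply Rle_lt_trans with (1 := Cmod_triangle3 _ _ _); rewrite !Cmod_mult.
assert (Pa := Cmod_ge_0 a); assert (Pb := Cmod_ge_0 b).
assert (Cmod a * Cmod b < e) by nra.
assert (Cmod a * Cmod (g z) <= e * Cmod (g z)) by (apply Rmult_le_compat_r; lra).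
assert (Cmod (f z) * Cmod b <= Cmod (f z) * e) by (apply Rmult_le_compat_l; lra).
unfold K in He2; lra.
Qed.

Lemma ccont_const (c z : C) : ccont (fun _ => c) z.
Proof. apply cderiv_ccont with (RtoC 0), cderiv_const. Qed.

Definition Cexp (z : C) : C := (exp (Re z) * cos (Im z), exp (Re z) * sin (Im z)).

Lemma Cexp_plus (z w : C) : Cexp (z + w) = (Cexp z * Cexp w)%C.
Proof.
destruct z as [x y]; destruct w as [u v]; unfold Cexp, Cmult, Cplus; simpl.
rewrite exp_plus, cos_plus, sin_plus; f_equal; ring.
Qed.

Lemma Cexp_0 : Cexp 0 = 1.
Proof.
unfold Cexp, RtoC; simpl; rewrite exp_0, cos_0, sin_0; f_equal; ring.
Qed.

Lemma Cmod_Cexp (z : C) : Cmod (Cexp z) = exp (Re z).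
Proof.
unfold Cexp, Cmod; simpl.
replace (_ + _) with ((exp (Re z))²).
2: { assert (H := sin2_cos2 (Im z)); unfold Rsqr in *; nra. }
apply sqrt_Rsqr, Rlt_le, exp_pos.
Qed.

Lemma Cexp_neq_0 (z : C) : Cexp z <> 0.
Proof. apply Cmod_gt_0; rewrite Cmod_Cexp; apply exp_pos. Qed.

Lemma Cmod_le_Re_Im (z : C) : Cmod z <= Rabs (Re z) + Rabs (Im z).
Proof.
destruct z as [x y]; simpl.
replace (x, y) with (RtoC x + Ci * RtoC y)%C
  by (unfold RtoC, Ci, Cplus, Cmult; simpl; f_equal; ring).
apply Rle_trans with (1 := Cmod_triangle _ _).
rewrite Cmod_mult, Cmod_Ci, !Cmod_R; lra.
Qed.

Lemma im_le_Cmod (z : C) : Rabs (Im z) <= Cmod z.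
Proof. eapply Rle_trans; [apply Rmax_r | apply Rmax_Cmod]. Qed.

Lemma derivable_pt_lim_bound (f : R -> R) (l : R) : derivable_pt_lim f 0 l ->
  forall eps, 0 < eps -> exists del, 0 < del /\ forall h, Rabs h < del ->
    Rabs (f h - f 0 - l * h) <= eps * Rabs h.
Proof.
intros H eps Heps; destruct (H eps Heps) as [d Hd].
exists d; split; [apply cond_pos|]; intros h Hh.
destruct (Req_dec h 0) as [->|Hn].
{ replace (f 0 - f 0 - l * 0) with 0 by ring; rewrite Rabs_R0; lra. }
specialize (Hd h Hn Hh); rewrite Rplus_0_l in Hd.
replace (f h - f 0 - l * h) with (((f h - f 0) / h - l) * h) by (field; exact Hn).
rewrite Rabs_mult; apply Rmult_le_compat_r; [apply Rabs_pos | lra].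
Qed.

(** At the origin the claim reduces to the real remainders of [exp], [cos] and [sin]; the functional
    equation carries it to every other point. *)
Lemma cderiv_Cexp_0 : cderiv Cexp 0 1.
Proof.
(* The constant is 4 + 5, from the bounds [Y1] and [Y2] on the real and imaginary parts of the
   error. *)
apply cderiv_of_bound with 9; [lra|]; intros e He.
destruct (derivable_pt_lim_bound exp 1) with (eps := e) as [d1 [Hd1 H1]];
  [apply derivable_pt_lim_exp_0 | lra |].
destruct (derivable_pt_lim_bound cos 0) with (eps := e) as [d2 [Hd2 H2]];
  [pose proof (derivable_pt_lim_cos 0) as X; now rewrite sin_0, Ropp_0 in X | lra |].
destruct (derivable_pt_lim_bound sin 1) with (eps := e) as [d3 [Hd3 H3]];
  [pose proof (derivable_pt_lim_sin 0) as X; now rewrite cos_0 in X | lra |].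
exists (Rmin e (Rmin d1 (Rmin d2 d3))); split;
  [repeat apply Rmin_pos; lra|]; intros [x y] Hm.
assert (Hx : Rabs x <= Cmod (x, y)) by apply (re_le_Cmod (x, y)).
assert (Hy : Rabs y <= Cmod (x, y)) by apply (im_le_Cmod (x, y)).
set (r := Cmod (x, y)) in *.
apply Rmin_Rgt in Hm; destruct Hm as [M0 Hm].
apply Rmin_Rgt in Hm; destruct Hm as [M1 Hm].
apply Rmin_Rgt in Hm; destruct Hm as [M2 M3].
specialize (H1 x ltac:(lra)); specialize (H2 y ltac:(lra)).
specialize (H3 y ltac:(lra)).
rewrite exp_0 in H1; rewrite cos_0 in H2; rewrite sin_0 in H3.
set (a := exp x - 1 - 1 * x) in *; set (b := cos y - 1 - 0 * y) in *.
set (c := sin y - 0 - 1 * y) in *.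
rewrite Cplus_0_l, Cexp_0.
apply Rle_trans with (1 := Cmod_le_Re_Im _); unfold Cexp; simpl.
replace (exp x * cos y + - (1) + - (1 * x - 0 * y)) with (a * (1 + b) + (1 + x) * b)
  by (unfold a, b; ring).
replace (exp x * sin y + - 0 + - (1 * y + 0 * x))
  with (a * (y + c) + x * y + (1 + x) * c) by (unfold a, c; ring).
assert (Hr : 0 <= r) by apply Cmod_ge_0.
assert (Pa := Rabs_pos a); assert (Pb := Rabs_pos b); assert (Pc := Rabs_pos c).
assert (Ha : Rabs a <= e * r) by nra.
assert (Hb : Rabs b <= e * r) by nra.
assert (Hc : Rabs c <= e * r) by nra.
assert (er : e * r <= 1) by nra.
assert (X1 : Rabs (1 + b) <= 2).
{ apply Rle_trans with (1 := Rabs_triang _ _); rewrite Rabs_R1; lra. }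
assert (X2 : Rabs (1 + x) <= 2).
{ apply Rle_trans with (1 := Rabs_triang _ _); rewrite Rabs_R1; lra. }
assert (X3 : Rabs (y + c) <= 2).
{ apply Rle_trans with (1 := Rabs_triang _ _); lra. }
assert (Px := Rabs_pos x); assert (Py := Rabs_pos y).
assert (Y1 : Rabs (a * (1 + b) + (1 + x) * b) <= e * r * 2 + 2 * (e * r)).
{ apply Rle_trans with (1 := Rabs_triang _ _); rewrite !Rabs_mult.
  apply Rplus_le_compat; apply Rmult_le_compat; auto using Rabs_pos. }
assert (Y2 : Rabs (a * (y + c) + x * y + (1 + x) * c) <= e * r * 2 + e * r + 2 * (e * r)).
{ apply Rle_trans with (1 := Rabs_triang _ _).
  apply Rplus_le_compat.
  - apply Rle_trans with (1 := Rabs_triang _ _); rewrite !Rabs_mult.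
    apply Rplus_le_compat; apply Rmult_le_compat; auto using Rabs_pos; lra.
  - rewrite Rabs_mult; apply Rmult_le_compat; auto using Rabs_pos. }
lra.
Qed.

Lemma cderiv_Cexp (z : C) : cderiv Cexp z (Cexp z).
Proof.
intros eps Heps.
assert (Pz := proj1 (Cmod_gt_0 _) (Cexp_neq_0 z)).
destruct (cderiv_Cexp_0 (eps / Cmod (Cexp z))) as [d [Hd H]].
{ now apply Rdiv_lt_0_compat. }
exists d; split; [exact Hd|]; intros h Hh; specialize (H h Hh).
rewrite Cplus_0_l, Cexp_0 in H.
replace (Cexp (z + h) - Cexp z - Cexp z * h)%C with (Cexp z * (Cexp h - 1 - 1 * h))%C
  by (rewrite Cexp_plus; ring).
rewrite Cmod_mult; apply Rle_trans with (1 := Rmult_le_compat_l _ _ _ (Rlt_le _ _ Pz) H).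
right; field; lra.
Qed.

(** * Integrals along segments *)

(** The integrand is a function of a complex variable restricted to the real line, so that [ccont]
    and [cderiv] serve for integrals too and no second calculus for maps from R to C is required. *)
Definition rint (f : C -> C) (a b : R) : C :=
  RInt (V := C_R_CompleteNormedModule) (fun t => f (RtoC t)) a b.

Lemma norm_C_R (z : C) : norm (V := C_R_NormedModule) z = Cmod z.
Proof.
unfold norm; simpl; unfold prod_norm, Cmod, norm; simpl; unfold abs; simpl.
f_equal; rewrite !Rmult_1_r, <- !Rabs_mult.
rewrite !Rabs_pos_eq by apply Rle_0_sqr; reflexivity.
Qed.

Lemma scal_C_R (x : R) (z : C) : scal (V := C_R_NormedModule) x z = (RtoC x * z)%C.
Proof.
destruct z as [u v]; unfold Cmult, RtoC; simpl.
change (scal x (u, v)) with (x * u, x * v); f_equal; ring.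
Qed.

Lemma ccont_continuous (f : C -> C) (t : R) : ccont f (RtoC t) ->
  continuous (U := C_R_NormedModule) (fun s : R => f (RtoC s)) t.
Proof.
intros H; apply (filterlim_locally_ball_norm (U := C_R_NormedModule)).
intros eps; destruct (H eps (cond_pos eps)) as [d [Hd Hh]].
exists (mkposreal d Hd); intros s Hs; unfold ball_norm; rewrite norm_C_R.
assert (Hm : Cmod (RtoC (s - t)) < d) by (rewrite Cmod_R; exact Hs).
specialize (Hh _ Hm); rewrite RtoC_minus in Hh.
replace (t + (s - t))%C with (RtoC s) in Hh by ring; exact Hh.
Qed.

Lemma cderiv_R_derive (f : C -> C) (t : R) (l : C) : cderiv f (RtoC t) l ->
  is_derive (V := C_R_NormedModule) (fun s : R => f (RtoC s)) t l.
Proof.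
intros H; split; [apply is_linear_scal_l|]; intros x Hx.
assert (Ex : t = x) by (apply (is_filter_lim_locally_unique _ _ Hx)).
subst x; intros eps; destruct (H eps (cond_pos eps)) as [d [Hd Hh]].
exists (mkposreal d Hd).
assert (G : forall s : R, Rabs (s - t) < d ->
  Cmod (f s - f t - RtoC (s - t) * l)%C <= eps * Rabs (s - t)).
{ intros s Hs; specialize (Hh (RtoC (s - t))); rewrite Cmod_R in Hh.
  specialize (Hh Hs).
  replace (t + RtoC (s - t))%C with (RtoC s) in Hh by (rewrite RtoC_minus; ring).
  now rewrite Cmult_comm. }
intros s Hs; rewrite norm_C_R, scal_C_R; apply G, Hs.
Qed.

Definition cont_on (f : C -> C) (a b : R) : Prop :=
  forall t, a <= t <= b -> ccont f (RtoC t).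

Lemma cont_on_sub (f : C -> C) (a b c d : R) :
  cont_on f a b -> a <= c -> d <= b -> cont_on f c d.
Proof. intros H Hc Hd t Ht; apply H; lra. Qed.

Lemma cont_on_ex_RInt (f : C -> C) (a b : R) :
  cont_on f (Rmin a b) (Rmax a b) ->
  ex_RInt (V := C_R_CompleteNormedModule) (fun t => f (RtoC t)) a b.
Proof. intros H; apply ex_RInt_continuous; intros t Ht; now apply ccont_continuous, H. Qed.

Lemma rint_correct (f : C -> C) (a b : R) : a <= b -> cont_on f a b ->
  is_RInt (V := C_R_CompleteNormedModule) (fun t => f (RtoC t)) a b (rint f a b).
Proof.
intros Hab H.
apply (RInt_correct (V := C_R_CompleteNormedModule) (fun t => f (RtoC t))), cont_on_ex_RInt.
now rewrite Rmin_left, Rmax_right.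
Qed.

Lemma rint_unique (f : C -> C) (a b : R) (v : C) :
  is_RInt (V := C_R_CompleteNormedModule) (fun t => f (RtoC t)) a b v -> rint f a b = v.
Proof. exact (is_RInt_unique (V := C_R_CompleteNormedModule) (fun t => f (RtoC t)) a b v). Qed.

Lemma rint_ext (f g : C -> C) (a b : R) : a <= b ->
  (forall t, a <= t <= b -> f (RtoC t) = g (RtoC t)) -> rint f a b = rint g a b.
Proof.
intros Hab H.
apply (RInt_ext (V := C_R_CompleteNormedModule) (fun t => f (RtoC t))); intros t Ht.
rewrite Rmin_left, Rmax_right in Ht by exact Hab; apply H; lra.
Qed.

Lemma rint_plus (f g : C -> C) (a b : R) : a <= b -> cont_on f a b ->
  cont_on g a b -> rint (fun z => f z + g z)%C a b = (rint f a b + rint g a b)%C.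
Proof.
intros Hab Hf Hg; apply rint_unique.
apply (is_RInt_plus (V := C_R_NormedModule)); now apply rint_correct.
Qed.

(* Coquelicot only provides multiplication by real scalars. *)
Lemma rint_scal (c : C) (f : C -> C) (a b : R) : a <= b -> cont_on f a b ->
  rint (fun z => c * f z)%C a b = (c * rint f a b)%C.
Proof.
intros Hab Hf; apply rint_unique.
assert (H := rint_correct f a b Hab Hf).
assert (H1 := is_RInt_fct_extend_fst (U := R_NormedModule) (V := R_NormedModule) _ _ _ _ H).
assert (H2 := is_RInt_fct_extend_snd (U := R_NormedModule) (V := R_NormedModule) _ _ _ _ H).
destruct c as [u v]; destruct (rint f a b) as [p q]; simpl in H1, H2.
apply (is_RInt_fct_extend_pair (U := R_NormedModule) (V := R_NormedModule)).
- apply (is_RInt_minus (V := R_NormedModule)); now apply (is_RInt_scal (V := R_NormedModule)).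
- apply (is_RInt_plus (V := R_NormedModule)); now apply (is_RInt_scal (V := R_NormedModule)).
Qed.

Lemma Cmod_rint_le (f : C -> C) (g : R -> R) (a b v : R) : a <= b -> cont_on f a b ->
  (forall t, a <= t <= b -> Cmod (f (RtoC t)) <= g t) -> is_RInt g a b v ->
  Cmod (rint f a b) <= v.
Proof.
intros Hab Hf H Hg; rewrite <- norm_C_R.
apply (norm_RInt_le (V := C_R_NormedModule) (fun t => f (RtoC t)) g a b _ _ Hab);
  [| now apply rint_correct | exact Hg].
intros t Ht; rewrite norm_C_R; now apply H.
Qed.

Lemma Cmod_rint_le_const (f : C -> C) (a b M : R) : a <= b -> cont_on f a b ->
  (forall t, a <= t <= b -> Cmod (f (RtoC t)) <= M) ->
  Cmod (rint f a b) <= (b - a) * M.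
Proof.
intros Hab Hf H; apply Cmod_rint_le with (fun _ => M); auto.
apply (is_RInt_const (V := R_NormedModule)).
Qed.

Lemma rint_derive (F f : C -> C) (a b : R) : a <= b ->
  (forall t, a <= t <= b -> cderiv F (RtoC t) (f (RtoC t))) -> cont_on f a b ->
  rint f a b = (F (RtoC b) - F (RtoC a))%C.
Proof.
intros Hab HF Hf; apply rint_unique.
apply (is_RInt_derive (V := C_R_CompleteNormedModule) (fun t => F (RtoC t)));
  rewrite Rmin_left, Rmax_right by exact Hab; intros t Ht.
- now apply cderiv_R_derive, HF.
- now apply ccont_continuous, Hf.
Qed.

Lemma rint_Chasles (f : C -> C) (a b c : R) : a <= b <= c -> cont_on f a c ->
  rint f a c = (rint f a b + rint f b c)%C.
Proof.
intros Hab Hf; symmetry.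
apply (RInt_Chasles (V := C_R_CompleteNormedModule) (fun t => f (RtoC t)));
  apply cont_on_ex_RInt; rewrite Rmin_left, Rmax_right by lra;
  apply cont_on_sub with (1 := Hf); lra.
Qed.

Lemma rint_swap (f : C -> C) (a b : R) : cont_on f (Rmin a b) (Rmax a b) ->
  rint f b a = (- rint f a b)%C.
Proof.
intros Hf; apply rint_unique, (is_RInt_swap (V := C_R_NormedModule)).
apply (RInt_correct (V := C_R_CompleteNormedModule) (fun t => f (RtoC t))).
now apply cont_on_ex_RInt.
Qed.

Lemma rint_affine (f : C -> C) (u v : R) : cont_on f (Rmin u v) (Rmax u v) ->
  (RtoC (v - u) * rint (fun t => f (u + t * (v - u)))%C 0 1)%C = rint f u v.
Proof.
intros Hf.
assert (Hc : cont_on (fun t => f (u + t * (v - u)))%C 0 1).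
{ intros t Ht; apply (ccont_comp f (fun t => u + t * (v - u))%C).
  - rewrite <- RtoC_minus, <- RtoC_mult, <- RtoC_plus; apply Hf.
    unfold Rmin, Rmax; destruct (Rle_dec u v); nra.
  - eapply cderiv_ccont, cderiv_affine. }
rewrite <- rint_scal by (lra || exact Hc); unfold rint.
assert (H := RInt_comp_lin (V := C_R_CompleteNormedModule)
  (fun t => f (RtoC t)) (v - u) u 0 1).
replace ((v - u) * 0 + u) with u in H by ring.
replace ((v - u) * 1 + u) with v in H by ring.
rewrite <- H by now apply cont_on_ex_RInt.
apply (RInt_ext (V := C_R_CompleteNormedModule)); intros t _; rewrite (scal_C_R (v - u)); do 2 f_equal.
rewrite RtoC_plus, RtoC_mult, RtoC_minus; ring.
Qed.

Definition seg_int (f : C -> C) (a b : C) : C :=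
  ((b - a) * rint (fun t => f (a + t * (b - a)))%C 0 1)%C.

Definition seg_cont (f : C -> C) (a b : C) : Prop :=
  forall t, 0 <= t <= 1 -> ccont f (a + RtoC t * (b - a))%C.

Lemma seg_cont_on (f : C -> C) (a d : C) (u v : R) :
  (forall t, u <= t <= v -> ccont f (a + RtoC t * d)%C) ->
  cont_on (fun t => f (a + t * d))%C u v.
Proof.
intros H t Ht; apply (ccont_comp f (fun t => a + t * d)%C); [now apply H|].
eapply cderiv_ccont, cderiv_affine.
Qed.

(** Pieces of one line, traversed in either direction, become subintervals for a single integrand;
    splitting and reversing a segment then follow from [rint_Chasles] and [rint_swap]. Reversal is
    the case [u = 1], [v = 0]. *)
Lemma seg_int_line (f : C -> C) (a d : C) (u v : R) :
  (forall t, Rmin u v <= t <= Rmax u v -> ccont f (a + RtoC t * d)%C) ->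
  seg_int f (a + u * d) (a + v * d) = (d * rint (fun t => f (a + t * d))%C u v)%C.
Proof.
intros H; rewrite <- rint_affine by now apply seg_cont_on.
unfold seg_int; rewrite RtoC_minus.
replace (rint (fun t => f (a + u * d + t * (a + v * d - (a + u * d))))%C 0 1)
  with (rint (fun t => f (a + (u + t * (v - u)) * d))%C 0 1); [ring|].
apply rint_ext; [lra|]; intros t _; f_equal; ring.
Qed.

Lemma seg_int_split (f : C -> C) (a b : C) (s : R) : 0 <= s <= 1 ->
  seg_cont f a b ->
  seg_int f a b = (seg_int f a (a + s * (b - a)) + seg_int f (a + s * (b - a)) b)%C.
Proof.
intros Hs H.
assert (H0 := seg_int_line f a (b - a) 0 s); assert (H1 := seg_int_line f a (b - a) s 1).
assert (H2 := seg_int_line f a (b - a) 0 1).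
rewrite Rmin_left, Rmax_right in H0, H1, H2 by lra.
replace (a + 0 * (b - a))%C with a in H0, H2 by ring.
replace (a + 1 * (b - a))%C with b in H1, H2 by ring.
rewrite H0, H1, H2, (rint_Chasles _ 0 s 1); [ring | lra | | | |];
  [apply seg_cont_on | | |]; intros t Ht; apply H; lra.
Qed.

Lemma seg_int_swap (f : C -> C) (a b : C) : seg_cont f a b ->
  seg_int f b a = (- seg_int f a b)%C.
Proof.
intros H.
assert (H0 := seg_int_line f a (b - a) 1 0); assert (H2 := seg_int_line f a (b - a) 0 1).
rewrite Rmin_left, Rmax_right in H2 by lra; rewrite Rmin_right, Rmax_left in H0 by lra.
replace (a + 0 * (b - a))%C with a in H0, H2 by ring.
replace (a + 1 * (b - a))%C with b in H0, H2 by ring.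
rewrite H0, H2 by exact H; rewrite rint_swap; [ring|].
rewrite Rmin_left, Rmax_right by lra; now apply seg_cont_on.
Qed.

Lemma seg_int_bound (f : C -> C) (a b : C) (M : R) : seg_cont f a b ->
  (forall t, 0 <= t <= 1 -> Cmod (f (a + RtoC t * (b - a))%C) <= M) ->
  Cmod (seg_int f a b) <= Cmod (b - a) * M.
Proof.
intros H HM; unfold seg_int; rewrite Cmod_mult.
apply Rmult_le_compat_l; [apply Cmod_ge_0|].
replace M with ((1 - 0) * M) by ring.
apply Cmod_rint_le_const; [lra | now apply seg_cont_on | exact HM].
Qed.

Lemma seg_int_plus (f g : C -> C) (a b : C) : seg_cont f a b -> seg_cont g a b ->
  seg_int (fun z => f z + g z)%C a b = (seg_int f a b + seg_int g a b)%C.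
Proof.
intros Hf Hg; unfold seg_int.
rewrite (rint_plus (fun t => f (a + t * (b - a)))%C (fun t => g (a + t * (b - a)))%C);
  [ring | lra | now apply seg_cont_on | now apply seg_cont_on].
Qed.

Lemma seg_int_derive (F f : C -> C) (a b : C) : seg_cont f a b ->
  (forall t, 0 <= t <= 1 ->
     cderiv F (a + RtoC t * (b - a))%C (f (a + RtoC t * (b - a))%C)) ->
  seg_int f a b = (F b - F a)%C.
Proof.
intros Hf HF; unfold seg_int.
rewrite <- rint_scal; [| lra | now apply seg_cont_on].
rewrite (rint_derive (fun t => F (a + t * (b - a)))%C).
- f_equal; [f_equal; ring|]; do 2 f_equal; ring.
- lra.
- intros t Ht; rewrite Cmult_comm.
  apply (cderiv_comp F (fun t => a + t * (b - a))%C); [now apply HF|].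
  apply cderiv_affine.
- intros t Ht; apply ccont_mult; [apply ccont_const|].
  revert t Ht; now apply seg_cont_on.
Qed.

(** * Goursat's theorem *)

Definition convex_set (D : C -> Prop) : Prop :=
  forall a b t, D a -> D b -> 0 <= t <= 1 -> D (a + RtoC t * (b - a))%C.

(** Closedness is phrased with sequences because it is applied to the vertices of nested triangles,
    whose limit must stay where [f] is differentiable. *)
Definition seq_closed (D : C -> Prop) : Prop :=
  forall (p : nat -> C) (L : C), (forall n, D (p n)) ->
    (forall eps, 0 < eps -> exists n, Cmod (p n - L) < eps) -> D L.

Definition tri_int (f : C -> C) (a b c : C) : C :=
  (seg_int f a b + seg_int f b c + seg_int f c a)%C.

Lemma half_pow_small (S eps : R) : 0 <= S -> 0 < eps -> exists n, S / 2 ^ n < eps.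
Proof.
intros HS He.
destruct (pow_lt_1_zero (/ 2)) with (y := eps / (S + 1)) as [N HN].
{ rewrite Rabs_pos_eq; lra. }
{ apply Rdiv_lt_0_compat; lra. }
exists N; specialize (HN N (le_n _)); rewrite Rabs_pos_eq in HN by (apply pow_le; lra).
rewrite pow_inv in HN; apply Rlt_div_r in HN; [|lra].
assert (0 < / 2 ^ N) by (apply Rinv_0_lt_compat, pow_lt; lra).
unfold Rdiv; nra.
Qed.

(** The intervals of radius [2 * (S / 2 ^ n)] around [x n] are nested, since the radius drops by
    [S / 2 ^ n] at each step; the limit is the supremum of their left endpoints. *)
Lemma geometric_limit_R (x : nat -> R) (S : R) :
  (forall n, Rabs (x (Datatypes.S n) - x n) <= S / 2 ^ n) ->
  exists l, forall n, Rabs (x n - l) <= 2 * (S / 2 ^ n).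
Proof.
intros H.
assert (E : forall n, S / 2 ^ Datatypes.S n = S / 2 ^ n / 2).
{ intros n; simpl; field; apply pow_nonzero; lra. }
assert (P : forall n, 0 <= S / 2 ^ n).
{ intros n; apply Rle_trans with (2 := H n), Rabs_pos. }
assert (Ga : Un_growing (fun n => x n - 2 * (S / 2 ^ n))).
{ intros n; rewrite E; specialize (H n); apply Rabs_le_between in H; lra. }
assert (Gb : Un_decreasing (fun n => x n + 2 * (S / 2 ^ n))).
{ intros n; rewrite E; specialize (H n); apply Rabs_le_between in H; lra. }
assert (AB : forall n m, x n - 2 * (S / 2 ^ n) <= x m + 2 * (S / 2 ^ m)).
{ intros n m; set (k := max n m).
  assert (A := growing_prop _ k n Ga (Nat.le_max_l _ _)).
  assert (B := decreasing_prop _ m k Gb (Nat.le_max_r _ _)).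
  specialize (P k); simpl in A, B; lra. }
destruct (completeness (fun y => exists n, y = x n - 2 * (S / 2 ^ n))) as [l [L1 L2]].
{ exists (x O + 2 * (S / 2 ^ 0)); intros y [n ->]; apply AB. }
{ exists (x O - 2 * (S / 2 ^ 0)); now exists O. }
exists l; intros n.
assert (A : x n - 2 * (S / 2 ^ n) <= l) by (apply L1; now exists n).
assert (B : l <= x n + 2 * (S / 2 ^ n)) by (apply L2; intros y [m ->]; apply AB).
apply Rabs_le; lra.
Qed.

Lemma geometric_limit_C (p : nat -> C) (S : R) :
  (forall n, Cmod (p (Datatypes.S n) - p n) <= S / 2 ^ n) ->
  exists L : C, forall n, Cmod (p n - L) <= 4 * (S / 2 ^ n).
Proof.
intros H.
destruct (geometric_limit_R (fun n => Re (p n)) S) as [u Hu].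
{ intros n; apply Rle_trans with (2 := H n).
  exact (re_le_Cmod (p (Datatypes.S n) - p n)). }
destruct (geometric_limit_R (fun n => Im (p n)) S) as [v Hv].
{ intros n; apply Rle_trans with (2 := H n).
  exact (im_le_Cmod (p (Datatypes.S n) - p n)). }
exists (u, v); intros n; specialize (Hu n); specialize (Hv n).
apply Rle_trans with (1 := Cmod_le_Re_Im _).
change (Rabs (Re (p n) - u) + Rabs (Im (p n) - v) <= 4 * (S / 2 ^ n)); lra.
Qed.

(** The fourth triangle is the middle one, based at the midpoint of the side opposite [p], with both
    edge vectors negated. This keeps the orientation, so every inner edge occurs once in each
    direction and cancels. *)
Lemma tri_int_split (f : C -> C) (D : C -> Prop) (p u v : C) : convex_set D ->
  (forall z, D z -> ccont f z) -> D p -> D (p + u)%C -> D (p + v)%C ->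
  tri_int f p (p + u) (p + v) =
  (tri_int f p (p + u / 2) (p + v / 2)
   + tri_int f (p + u / 2) (p + u / 2 + u / 2) (p + u / 2 + v / 2)
   + tri_int f (p + v / 2) (p + v / 2 + u / 2) (p + v / 2 + v / 2)
   + tri_int f (p + u / 2 + v / 2) (p + u / 2 + v / 2 - u / 2) (p + u / 2 + v / 2 - v / 2))%C.
Proof.
intros cvx Hf Dp Du Dv.
assert (HC : forall a b, D a -> D b -> seg_cont f a b).
{ intros a b Da Db t Ht; now apply Hf, cvx. }
assert (mid : forall a b c, D a -> D b -> c = ((a + b) / 2)%C ->
  D c /\ seg_int f a b = (seg_int f a c + seg_int f c b)%C).
{ intros a b c Da Db Hc.
  assert (E : c = (a + RtoC (/ 2) * (b - a))%C).
  { rewrite Hc, RtoC_inv by lra; field; intros X; apply RtoC_inj in X; lra. }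
  rewrite E; split; [apply cvx; auto; lra|].
  apply seg_int_split; [lra | now apply HC]. }
assert (two : RtoC 2 <> 0) by (intros X; apply RtoC_inj in X; lra).
destruct (mid p (p + u)%C (p + u / 2)%C Dp Du) as [D1 E1]; [field; exact two|].
destruct (mid (p + v)%C p (p + v / 2)%C Dv Dp) as [D2 E2]; [field; exact two|].
destruct (mid (p + u)%C (p + v)%C (p + u / 2 + v / 2)%C Du Dv) as [D3 E3];
  [field; exact two|].
unfold tri_int; rewrite E1, E2, E3.
replace (p + u / 2 + u / 2)%C with (p + u)%C by (field; exact two).
replace (p + v / 2 + v / 2)%C with (p + v)%C by (field; exact two).
replace (p + v / 2 + u / 2)%C with (p + u / 2 + v / 2)%C by ring.
replace (p + u / 2 + v / 2 - u / 2)%C with (p + v / 2)%C by ring.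
replace (p + u / 2 + v / 2 - v / 2)%C with (p + u / 2)%C by ring.
rewrite (seg_int_swap f (p + u / 2) (p + v / 2)) by now apply HC.
rewrite (seg_int_swap f (p + u / 2) (p + u / 2 + v / 2)) by now apply HC.
rewrite (seg_int_swap f (p + u / 2 + v / 2) (p + v / 2)) by now apply HC.
ring.
Qed.

Lemma Cmod_sum4_large (a b c d : C) : let s := Cmod (a + b + c + d) in
  s / 4 <= Cmod a \/ s / 4 <= Cmod b \/ s / 4 <= Cmod c \/ s / 4 <= Cmod d.
Proof.
intros s.
assert (s <= Cmod a + Cmod b + Cmod c + Cmod d).
{ apply Rle_trans with (1 := Cmod_triangle _ _).
  apply Rplus_le_compat_r, Cmod_triangle3. }
lra.
Qed.

(* A triangle is encoded by a vertex and its two edge vectors, so that bisection halves the vectors up to sign. *)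
Lemma tri_int_bisect (f : C -> C) (D : C -> Prop) (p u v : C) : convex_set D ->
  (forall z, D z -> ccont f z) -> D p -> D (p + u)%C -> D (p + v)%C ->
  exists p' u' v' : C, (D p' /\ D (p' + u')%C /\ D (p' + v')%C) /\
    Cmod u' = Cmod u / 2 /\ Cmod v' = Cmod v / 2 /\ Cmod (p' - p) <= Cmod u + Cmod v /\
    Cmod (tri_int f p (p + u) (p + v)) / 4 <= Cmod (tri_int f p' (p' + u') (p' + v')).
Proof.
intros cvx Hf Dp Du Dv.
assert (two : RtoC 2 <> 0) by (intros X; apply RtoC_inj in X; lra).
assert (half : forall w : C, Cmod (w / 2) = Cmod w / 2).
{ intros w; rewrite Cmod_div, Cmod_R, Rabs_pos_eq by (exact two || lra); reflexivity. }
assert (mid : forall a b c, D a -> D b -> c = ((a + b) / 2)%C -> D c).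
{ intros a b c Da Db ->.
  replace ((a + b) / 2)%C with (a + RtoC (/ 2) * (b - a))%C.
  - apply cvx; auto; lra.
  - rewrite RtoC_inv by lra; field; exact two. }
assert (D1 : D (p + u / 2)%C) by (apply (mid p (p + u)%C); auto; field; exact two).
assert (D2 : D (p + v / 2)%C) by (apply (mid p (p + v)%C); auto; field; exact two).
assert (D3 : D (p + u / 2 + v / 2)%C)
  by (apply (mid (p + u)%C (p + v)%C); auto; field; exact two).
assert (Pu := Cmod_ge_0 u); assert (Pv := Cmod_ge_0 v).
rewrite (tri_int_split f D p u v cvx Hf Dp Du Dv).
destruct (Cmod_sum4_large
  (tri_int f p (p + u / 2) (p + v / 2))
  (tri_int f (p + u / 2) (p + u / 2 + u / 2) (p + u / 2 + v / 2))
  (tri_int f (p + v / 2) (p + v / 2 + u / 2) (p + v / 2 + v / 2))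
  (tri_int f (p + u / 2 + v / 2) (p + u / 2 + v / 2 - u / 2) (p + u / 2 + v / 2 - v / 2)))
  as [H|[H|[H|H]]].
- exists p, (u / 2)%C, (v / 2)%C; rewrite !half.
  replace (p - p)%C with (RtoC 0) by ring; rewrite Cmod_0.
  repeat split; auto; lra.
- exists (p + u / 2)%C, (u / 2)%C, (v / 2)%C; rewrite !half.
  replace (p + u / 2 - p)%C with (u / 2)%C by ring; rewrite half.
  replace (p + u / 2 + u / 2)%C with (p + u)%C in * by (field; exact two).
  repeat split; auto; lra.
- exists (p + v / 2)%C, (u / 2)%C, (v / 2)%C; rewrite !half.
  replace (p + v / 2 - p)%C with (v / 2)%C by ring; rewrite half.
  replace (p + v / 2 + v / 2)%C with (p + v)%C in * by (field; exact two).
  replace (p + v / 2 + u / 2)%C with (p + u / 2 + v / 2)%C in * by ring.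
  repeat split; auto; lra.
- exists (p + u / 2 + v / 2)%C, (- (u / 2))%C, (- (v / 2))%C; rewrite !Cmod_opp, !half.
  replace (p + u / 2 + v / 2 - p)%C with (u / 2 + v / 2)%C by ring.
  replace (p + u / 2 + v / 2 - u / 2)%C with (p + v / 2)%C in * by ring.
  replace (p + u / 2 + v / 2 - v / 2)%C with (p + u / 2)%C in * by ring.
  replace (p + u / 2 + v / 2 + - (u / 2))%C with (p + v / 2)%C by ring.
  replace (p + u / 2 + v / 2 + - (v / 2))%C with (p + u / 2)%C by ring.
  repeat split; auto.
  apply Rle_trans with (1 := Cmod_triangle _ _); rewrite !half; lra.
Qed.

(** The affine part of [f] at [L] has a primitive, so its contributions telescope around the
    triangle. What survives is the error, at most [eps * r] on each edge, over a perimeter of at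
    most [2 * (Cmod u + Cmod v)]. *)
Lemma tri_int_small (f : C -> C) (D : C -> Prop) (L l p u v : C) (r eps : R) :
  convex_set D -> (forall z, D z -> ccont f z) -> D p -> D (p + u)%C -> D (p + v)%C ->
  0 <= eps ->
  (forall h : C, Cmod h <= r -> Cmod (f (L + h) - f L - l * h)%C <= eps * Cmod h) ->
  Cmod (p - L) + (Cmod u + Cmod v) <= r ->
  Cmod (tri_int f p (p + u) (p + v)) <= 2 * (Cmod u + Cmod v) * (eps * r).
Proof.
intros cvx Hf Dp Du Dv He H Hr.
assert (Pu := Cmod_ge_0 u); assert (Pv := Cmod_ge_0 v).
set (err := fun z : C => (f z - f L - l * (z - L))%C).
set (aff := fun z : C => (f L + l * (z - L))%C).
set (prim := fun z : C => (f L * z + l * ((z - L) * (z - L) / 2))%C).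
assert (two : RtoC 2 <> 0) by (intros X; apply RtoC_inj in X; lra).
assert (Cmin : forall z, ccont (fun w : C => w - L)%C z).
{ intros z; eapply cderiv_ccont, cderiv_minus; [apply cderiv_id | apply cderiv_const]. }
assert (Hprim : forall z, cderiv prim z (aff z)).
{ intros z; eapply cderiv_eq.
  - apply cderiv_plus; [apply cderiv_scal, cderiv_id|].
    apply cderiv_scal; unfold Cdiv.
    apply (cderiv_mult (fun w => (w - L) * (w - L))%C (fun _ => / 2)%C);
      [|apply cderiv_const].
    apply (cderiv_mult (fun w => (w - L))%C (fun w => (w - L))%C);
    apply cderiv_minus; (apply cderiv_id || apply cderiv_const).
  - unfold aff; field; exact two. }
assert (Haff : forall z, ccont aff z).
{ intros z; apply ccont_plus; [apply ccont_const|].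
  apply ccont_mult; [apply ccont_const | apply Cmin]. }
assert (Herr : forall z : C, D z -> ccont err z).
{ intros z Hz; apply ccont_plus; [apply ccont_plus; [now apply Hf | apply ccont_const]|].
  intros e E; destruct (Haff z e E) as [d [Hd K]]; exists d; split; [exact Hd|].
  intros h Hh; specialize (K h Hh); unfold aff in K.
  rewrite <- Cmod_opp; replace (- (- (l * (z + h - L)) - - (l * (z - L))))%C
    with (f L + l * (z + h - L) - (f L + l * (z - L)))%C by ring; exact K. }
assert (edge : forall a b : C, D a -> D b ->
  (forall t, 0 <= t <= 1 -> Cmod (a + RtoC t * (b - a) - L) <= r) ->
  exists e : C, seg_int f a b = (prim b - prim a + e)%C /\
    Cmod e <= Cmod (b - a) * (eps * r)).
{ intros a b Da Db Hab; exists (seg_int err a b); split.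
  - rewrite <- (seg_int_derive prim aff).
    + rewrite <- seg_int_plus.
      * unfold seg_int; f_equal; apply rint_ext; [lra|]; intros t _.
        unfold aff, err; ring.
      * intros t _; apply Haff.
      * intros t Ht; now apply Herr, cvx.
    + intros t _; apply Haff.
    + intros t _; apply Hprim.
  - apply seg_int_bound; [intros t Ht; now apply Herr, cvx|].
    intros t Ht; specialize (Hab t Ht).
    set (z := (a + t * (b - a))%C) in *; specialize (H (z - L)%C Hab).
    replace (L + (z - L))%C with z in H by ring.
    apply Rle_trans with (1 := H), Rmult_le_compat_l; assumption. }
assert (inside : forall a b : C, (forall t, 0 <= t <= 1 ->
    Cmod (a + RtoC t * (b - a)) <= Cmod u + Cmod v) ->
    forall t, 0 <= t <= 1 -> Cmod (p + a + RtoC t * (p + b - (p + a)) - L) <= r).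
{ intros a b Hab t Ht; specialize (Hab t Ht).
  replace (p + a + RtoC t * (p + b - (p + a)) - L)%C
    with ((p - L) + (a + t * (b - a)))%C by ring.
  apply Rle_trans with (1 := Cmod_triangle _ _); lra. }
assert (Ct : forall t, 0 <= t <= 1 -> Cmod (RtoC t) = t).
{ intros t Ht; rewrite Cmod_R; apply Rabs_pos_eq; lra. }
destruct (edge p (p + u)%C Dp Du) as [e1 [E1 B1]].
{ intros t Ht.
  replace (p + t * (p + u - p) - L)%C with (p + 0 + t * (p + u - (p + 0)) - L)%C by ring.
  revert t Ht; apply inside; intros t Ht.
  replace (0 + t * (u - 0))%C with (t * u)%C by ring; rewrite Cmod_mult, Ct by exact Ht.
  nra. }
destruct (edge (p + u)%C (p + v)%C Du Dv) as [e2 [E2 B2]].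
{ apply inside; intros t Ht.
  replace (u + t * (v - u))%C with (RtoC (1 - t) * u + t * v)%C
    by (rewrite RtoC_minus; ring).
  apply Rle_trans with (1 := Cmod_triangle _ _); rewrite !Cmod_mult, !Ct by lra.
  nra. }
destruct (edge (p + v)%C p Dv Dp) as [e3 [E3 B3]].
{ intros t Ht.
  replace (p + v + t * (p - (p + v)) - L)%C with (p + v + t * (p + 0 - (p + v)) - L)%C by ring.
  revert t Ht; apply inside; intros t Ht.
  replace (v + t * (0 - v))%C with (RtoC (1 - t) * v)%C by (rewrite RtoC_minus; ring).
  rewrite Cmod_mult, Ct by lra; nra. }
unfold tri_int; rewrite E1, E2, E3.
replace (_ + _)%C with (e1 + e2 + e3)%C by ring.
apply Rle_trans with (1 := Cmod_triangle3 _ _ _).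
replace (p + u - p)%C with u in B1 by ring.
replace (p + v - (p + u))%C with (v - u)%C in B2 by ring.
replace (p - (p + v))%C with (- v)%C in B3 by ring; rewrite Cmod_opp in B3.
assert (Hs := Cmod_minus_le v u).
assert (Pr : 0 <= eps * r).
{ apply Rmult_le_pos; [exact He|]; assert (X := Cmod_ge_0 (p - L)); lra. }
assert (Cmod (v - u) * (eps * r) <= (Cmod v + Cmod u) * (eps * r))
  by now apply Rmult_le_compat_r.
lra.
Qed.

(** Dependent choice: bisection only asserts that a suitable subtriangle exists, while the nested
    triangles must form a sequence. *)
Lemma iterate_choice (X : Type) (good : X -> Prop) (next : X -> X -> Prop) (x0 : X) :
  good x0 -> (forall x, good x -> exists y, good y /\ next x y) ->
  exists s : nat -> X, s O = x0 /\ (forall n, good (s n)) /\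
    (forall n, next (s n) (s (S n))).
Proof.
intros G0 H.
set (step := fun x => epsilon (inhabits x0) (fun y => good y /\ next x y)).
assert (Hs : forall x, good x -> good (step x) /\ next x (step x)).
{ intros x Gx; apply (epsilon_spec (inhabits x0) (fun y => good y /\ next x y)), H, Gx. }
set (s := fix s n := match n with O => x0 | S m => step (s m) end).
assert (Gs : forall n, good (s n)).
{ induction n as [|n IH]; [exact G0 | exact (proj1 (Hs _ IH))]. }
exists s; split; [reflexivity | split; [exact Gs|]].
intros n; exact (proj2 (Hs _ (Gs n))).
Qed.

Lemma goursat (D : C -> Prop) (f : C -> C) (a b c : C) : convex_set D -> seq_closed D ->
  (forall z, D z -> exists l, cderiv f z l) -> D a -> D b -> D c ->
  tri_int f a b c = 0.
Proof.
intros cvx clo Hf Da Db Dc.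
assert (Cf : forall z, D z -> ccont f z).
{ intros z Dz; destruct (Hf z Dz) as [l Hl]; now apply cderiv_ccont in Hl. }
set (good := fun x : C * C * C => let '(p, u, v) := x in
  D p /\ D (p + u)%C /\ D (p + v)%C).
set (next := fun x y : C * C * C => let '(p, u, v) := x in let '(p', u', v') := y in
  Cmod u' = Cmod u / 2 /\ Cmod v' = Cmod v / 2 /\ Cmod (p' - p) <= Cmod u + Cmod v /\
    Cmod (tri_int f p (p + u) (p + v)) / 4 <= Cmod (tri_int f p' (p' + u') (p' + v'))).
destruct (iterate_choice (C * C * C) good next (a, b - a, c - a)%C) as [s [S0 [SG SN]]].
{ repeat split; [exact Da | |].
  - replace (a + (b - a))%C with b by ring; exact Db.
  - replace (a + (c - a))%C with c by ring; exact Dc. }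
{ intros [[p u] v] [Dp [Du Dv]].
  destruct (tri_int_bisect f D p u v cvx Cf Dp Du Dv) as [p' [u' [v' [G N]]]].
  now exists (p', u', v'). }
set (P := fun n => fst (fst (s n))); set (U := fun n => snd (fst (s n))).
set (V := fun n => snd (s n)).
set (size := Cmod (b - a) + Cmod (c - a)).
assert (Hs : 0 <= size).
{ assert (X1 := Cmod_ge_0 (b - a)); assert (X2 := Cmod_ge_0 (c - a)); unfold size; lra. }
assert (SG' : forall n, D (P n) /\ D (P n + U n)%C /\ D (P n + V n)%C).
{ intros n; specialize (SG n); unfold P, U, V.
  destruct (s n) as [[p u] v]; exact SG. }
assert (step : forall n, D (P n) /\ Cmod (U (S n)) = Cmod (U n) / 2 /\
  Cmod (V (S n)) = Cmod (V n) / 2 /\ Cmod (P (S n) - P n) <= Cmod (U n) + Cmod (V n) /\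
  Cmod (tri_int f (P n) (P n + U n) (P n + V n)) / 4 <=
  Cmod (tri_int f (P (S n)) (P (S n) + U (S n)) (P (S n) + V (S n)))).
{ intros n; specialize (SG n); specialize (SN n); unfold P, U, V.
  destruct (s n) as [[p u] v]; destruct (s (S n)) as [[p' u'] v']; simpl in *.
  tauto. }
assert (HUV : forall n, Cmod (U n) + Cmod (V n) = size / 2 ^ n).
{ induction n as [|n IH].
  - unfold U, V; rewrite S0; simpl; unfold size; field.
  - destruct (step n) as [_ [-> [-> _]]].
    replace (size / 2 ^ S n) with (size / 2 ^ n / 2)
      by (simpl; field; apply pow_nonzero; lra).
    rewrite <- IH; field. }
assert (HT : forall n, Cmod (tri_int f a b c) <=
  4 ^ n * Cmod (tri_int f (P n) (P n + U n) (P n + V n))).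
{ induction n as [|n IH].
  - unfold P, U, V; rewrite S0; simpl.
    replace (a + (b - a))%C with b by ring; replace (a + (c - a))%C with c by ring; lra.
  - destruct (step n) as [_ [_ [_ [_ Q]]]].
    apply Rle_trans with (1 := IH); simpl.
    assert (X : 0 < 4 ^ n) by (apply pow_lt; lra); nra. }
destruct (geometric_limit_C P size) as [L HL].
{ intros n; rewrite <- HUV; apply step. }
assert (DL : D L).
{ apply (clo P L); [intros n; apply step|]; intros eps He.
  destruct (half_pow_small (4 * size) eps) as [n Hn]; [lra | exact He|].
  exists n; apply Rle_lt_trans with (1 := HL n); unfold Rdiv in *; lra. }
destruct (Hf L DL) as [l Hl].
apply Cmod_eq_0, Rle_antisym; [|apply Cmod_ge_0].
apply le_epsilon; intros eps He; rewrite Rplus_0_l.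
(* With q = size / 2^n, the n-th triangle lies within 4 q + q of [L], so [tri_int_small] yields 2 q
   (e * 5 q); the factor 4^n turns this into 10 size^2 e. The summand 1 keeps the denominator
   positive. *)
set (e := eps / (10 * size * size + 1)).
assert (He' : 0 < e) by (apply Rdiv_lt_0_compat; nra).
destruct (Hl e He') as [d [Hd HLd]].
destruct (half_pow_small (5 * size) d) as [n Hn]; [lra | exact Hd|].
apply Rle_trans with (1 := HT n).
destruct (step n) as [DP _].
set (q := size / 2 ^ n) in *.
assert (Hq : 5 * q < d) by (unfold q, Rdiv in *; lra).
assert (pos2 : 0 < 2 ^ n) by (apply pow_lt; lra).
assert (B : Cmod (tri_int f (P n) (P n + U n) (P n + V n)) <=
  2 * (Cmod (U n) + Cmod (V n)) * (e * (5 * q))).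
{ assert (Pq : 0 <= q) by (unfold q; rewrite <- HUV; assert (X1 := Cmod_ge_0 (U n));
    assert (X2 := Cmod_ge_0 (V n)); lra).
  destruct (SG' n) as [G1 [G2 G3]].
  apply (tri_int_small f D L l (P n) (U n) (V n) (5 * q) e); auto; [lra | |].
  - intros h Hh; apply HLd; lra.
  - rewrite HUV; specialize (HL n); fold q; fold q in HL; lra. }
rewrite HUV in B; fold q in B.
apply Rle_trans with (4 ^ n * (2 * q * (e * (5 * q)))).
{ apply Rmult_le_compat_l; [apply pow_le; lra | exact B]. }
replace (4 ^ n * (2 * q * (e * (5 * q)))) with (e * (10 * size * size)).
2: { replace 4 with (2 * 2) by ring; rewrite Rpow_mult_distr; unfold q.
     field; lra. }
replace eps with (e * (10 * size * size + 1)) by (unfold e; field; nra).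
nra.
Qed.

(** * Primitives on the disc *)

Lemma Cmod_between (a b : C) (t : R) : 0 <= t <= 1 ->
  Cmod (a + RtoC t * (b - a)) <= Rmax (Cmod a) (Cmod b).
Proof.
intros Ht; replace (a + t * (b - a))%C with (RtoC (1 - t) * a + t * b)%C
  by (rewrite RtoC_minus; ring).
apply Rle_trans with (1 := Cmod_triangle _ _).
rewrite !Cmod_mult, !Cmod_R, !Rabs_pos_eq by lra.
assert (H1 := Rmax_l (Cmod a) (Cmod b)); assert (H2 := Rmax_r (Cmod a) (Cmod b)).
nra.
Qed.

Lemma unit_disc_convex : convex_set unit_disc.
Proof.
intros a b t Ha Hb Ht; unfold unit_disc in *.
apply Rle_lt_trans with (1 := Cmod_between a b t Ht); now apply Rmax_lub_lt.
Qed.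

Lemma unit_disc_near (z h : C) : unit_disc z -> Cmod h < 1 - Cmod z ->
  unit_disc (z + h)%C.
Proof.
unfold unit_disc; intros Hz Hh.
apply Rle_lt_trans with (1 := Cmod_triangle _ _); lra.
Qed.

Lemma seg_int_const (c a b : C) : seg_int (fun _ => c) a b = (c * (b - a))%C.
Proof.
rewrite (seg_int_derive (fun z => c * z)%C).
- ring.
- intros t _; apply ccont_const.
- intros t _; eapply cderiv_eq; [apply cderiv_scal, cderiv_id | ring].
Qed.

Lemma seg_int_near (k : C -> C) (z : C) (r : R) : 0 < r ->
  (forall h : C, Cmod h < r -> ccont k (z + h)%C) ->
  forall eps, 0 < eps -> exists del, 0 < del /\ forall h : C, Cmod h < del ->
    Cmod (seg_int k z (z + h) - k z * h) <= eps * Cmod h.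
Proof.
intros Hr Hk eps He.
destruct (Hk 0 ltac:(rewrite Cmod_0; exact Hr) eps He) as [d [Hd H]].
rewrite Cplus_0_r in H.
exists (Rmin r d); split; [now apply Rmin_pos|]; intros h Hh.
apply Rmin_Rgt in Hh; destruct Hh as [H1 H2].
assert (small : forall t, 0 <= t <= 1 -> Cmod (RtoC t * (z + h - z)) <= Cmod h).
{ intros t Ht; replace (z + h - z)%C with h by ring.
  rewrite Cmod_mult, Cmod_R, Rabs_pos_eq by lra.
  assert (X := Cmod_ge_0 h); nra. }
assert (SC : seg_cont k z (z + h)).
{ intros t Ht; apply Hk; specialize (small t Ht); lra. }
replace (seg_int k z (z + h) - k z * h)%C
  with (seg_int (fun w => k w + - k z)%C z (z + h)).
2: { rewrite (seg_int_plus k (fun _ => - k z)%C), seg_int_const; [ring | exact SC|].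
     intros t _; apply ccont_const. }
replace (eps * Cmod h) with (Cmod (z + h - z) * eps)
  by (replace (z + h - z)%C with h by ring; ring).
apply seg_int_bound.
- intros t Ht; apply ccont_plus; [now apply SC | apply ccont_const].
- intros t Ht; apply Rlt_le, H; specialize (small t Ht); lra.
Qed.

Lemma seg_int_same (k : C -> C) (z : C) : seg_int k z z = 0.
Proof. unfold seg_int; ring. Qed.

(** The open disc is not sequentially closed, so [goursat] cannot be applied to it directly. A
    smaller closed disc cut by a closed half-plane is both convex and closed, and [eta > 0] keeps
    [p] outside. *)
Definition lens (rho : R) (p d : C) (eta : R) (z : C) : Prop :=
  Cmod z <= rho /\ eta <= Re ((z - p) * d).

Lemma lens_convex (rho : R) (p d : C) (eta : R) : convex_set (lens rho p d eta).
Proof.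
intros a b t [A1 A2] [B1 B2] Ht; split.
- apply Rle_trans with (1 := Cmod_between a b t Ht); now apply Rmax_lub.
- replace ((a + t * (b - a) - p) * d)%C
    with (RtoC (1 - t) * ((a - p) * d) + RtoC t * ((b - p) * d))%C
    by (rewrite RtoC_minus; ring).
  rewrite re_plus, !re_scal_l; nra.
Qed.

Lemma lens_closed (rho : R) (p d : C) (eta : R) : seq_closed (lens rho p d eta).
Proof.
intros s L Hs HL; split.
- apply le_epsilon; intros eps He; destruct (HL eps He) as [n Hn].
  destruct (Hs n) as [H1 _]; assert (X := Cmod_minus_ge L (s n)).
  rewrite Cmod_minus_sym in X; lra.
- apply le_epsilon; intros eps He.
  assert (Pd := Cmod_ge_0 d).
  destruct (HL (eps / (Cmod d + 1))) as [n Hn]; [apply Rdiv_lt_0_compat; lra|].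
  destruct (Hs n) as [_ H2].
  replace ((s n - p) * d)%C with ((L - p) * d + (s n - L) * d)%C in H2 by ring.
  rewrite re_plus in H2.
  assert (X := re_le_Cmod ((s n - L) * d)); rewrite Cmod_mult in X.
  assert (Y := Rle_abs (Re ((s n - L) * d))).
  apply Rlt_div_r in Hn; [|lra].
  assert (Z := Cmod_ge_0 (s n - L)); nra.
Qed.

(* Cutting off the corner at the exceptional point [p] leaves triangles inside a half-plane avoiding [p]; the corner itself is negligible. *)
Lemma goursat_vertex (k : C -> C) (p z h : C) :
  (forall w, unit_disc w -> ccont k w) ->
  (forall w, unit_disc w -> w <> p -> exists l, cderiv k w l) ->
  unit_disc p -> unit_disc z -> unit_disc (z + h)%C -> z <> p ->
  Cmod h <= Cmod (z - p) / 2 ->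
  tri_int k p z (z + h) = 0.
Proof.
intros Hk Hd Dp Dz Dh zp Hh.
assert (SC : forall a b, unit_disc a -> unit_disc b -> seg_cont k a b).
{ intros a b Da Db t Ht; now apply Hk, unit_disc_convex. }
set (u := (z - p)%C) in *.
assert (Pu : 0 < Cmod u) by (apply Cmod_gt_0, Cminus_eq_contra, zp).
set (rho := Rmax (Cmod p) (Rmax (Cmod z) (Cmod (z + h)))).
assert (R1 : Cmod p <= rho) by apply Rmax_l.
assert (R2 : Cmod z <= rho) by (eapply Rle_trans; [apply Rmax_l | apply Rmax_r]).
assert (R3 : Cmod (z + h) <= rho) by (eapply Rle_trans; [apply Rmax_r | apply Rmax_r]).
assert (Hrho : rho < 1) by (repeat apply Rmax_lub_lt; assumption).
assert (Reu : Re (u * Cconj u) = Cmod u * Cmod u).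
{ rewrite <- Cmod2_conj, re_RtoC; ring. }
assert (Reh : Rabs (Re (h * Cconj u)) <= Cmod u * Cmod u / 2).
{ apply Rle_trans with (1 := re_le_Cmod _); rewrite Cmod_mult, Cmod_conj; nra. }
apply Rabs_le_between in Reh.
(* Shrinking the triangle towards [p] by the factor [s] removes the quadrilateral a, z, z + h, b. It
   is the union of two triangles away from [p], whose integrals vanish by [T1] and [T2]. *)
assert (cut : forall s, 0 < s <= 1 -> tri_int k p z (z + h) =
  tri_int k p (p + RtoC s * (z - p)) (p + RtoC s * (z + h - p))).
{ intros s Hs.
  set (a := (p + RtoC s * (z - p))%C); set (b := (p + RtoC s * (z + h - p))%C).
  (* Because |h| <= |u|/2, the term Re(h conj(u)) is at least -|u|^2/2. The vertex [b] thus reaches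
     the height s |u|^2/2, and so do [a], [z] and [z + h]. *)
  set (eta := s * (Cmod u * Cmod u) / 2).
  assert (Peta : 0 < eta) by (unfold eta; assert (0 < Cmod u * Cmod u) by nra; nra).
  set (D := lens rho p (Cconj u) eta).
  assert (Pu2 : 0 < Cmod u * Cmod u) by nra.
  assert (La : D a).
  { split.
    - apply Rle_trans with (1 := Cmod_between p z s ltac:(lra)); now apply Rmax_lub.
    - replace ((a - p) * Cconj u)%C with (s * (u * Cconj u))%C by (unfold a, u; ring).
      rewrite re_scal_l, Reu; unfold eta; nra. }
  assert (Lb : D b).
  { split.
    - apply Rle_trans with (1 := Cmod_between p (z + h) s ltac:(lra)); now apply Rmax_lub.
    - replace ((b - p) * Cconj u)%C with (s * (u * Cconj u + h * Cconj u))%C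
        by (unfold b, u; ring).
      rewrite re_scal_l, re_plus, Reu; unfold eta; nra. }
  assert (Lz : D z).
  { split; [exact R2|]; fold u; rewrite Reu; unfold eta; nra. }
  assert (Lh : D (z + h)%C).
  { split; [exact R3|].
    replace ((z + h - p) * Cconj u)%C with (u * Cconj u + h * Cconj u)%C
      by (unfold u; ring).
    rewrite re_plus, Reu; unfold eta; nra. }
  assert (DU : forall w, D w -> unit_disc w) by (intros w [W _]; unfold unit_disc; lra).
  assert (DD : forall w, D w -> exists l, cderiv k w l).
  { intros w Dw; apply Hd; [now apply DU|]; intros ->; destruct Dw as [_ W].
    replace ((p - p) * Cconj u)%C with (RtoC 0) in W by ring; rewrite re_RtoC in W; lra. }
  assert (T1 := goursat D k a z (z + h)%C (lens_convex _ _ _ _) (lens_closed _ _ _ _) DD La Lz Lh).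
  assert (T2 := goursat D k a (z + h)%C b (lens_convex _ _ _ _) (lens_closed _ _ _ _) DD La Lh Lb).
  unfold tri_int in *.
  rewrite (seg_int_split k p z s) by (lra || now apply SC); fold a.
  rewrite (seg_int_swap k p (z + h)) by now apply SC.
  rewrite (seg_int_split k p (z + h) s) by (lra || now apply SC); fold b.
  rewrite (seg_int_swap k p b) by (apply SC; auto).
  rewrite (seg_int_swap k a (z + h)) in T1 by (apply SC; auto).
  rewrite (seg_int_swap k b (z + h)), (seg_int_swap k a b) in T2 by (apply SC; auto).
  set (x1 := seg_int k a z) in *; set (x2 := seg_int k z (z + h)) in *.
  set (x3 := seg_int k a (z + h)) in *; set (x4 := seg_int k b (z + h)) in *.
  set (x5 := seg_int k a b) in *; set (x6 := seg_int k p a); set (x7 := seg_int k p b).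
  replace x2 with (x3 - x1 + (x1 + x2 + - x3))%C by ring; rewrite T1.
  replace x5 with (x3 - x4 - (x3 + - x4 + - x5))%C by ring; rewrite T2; ring. }
apply Cmod_eq_0, Rle_antisym; [|apply Cmod_ge_0].
apply le_epsilon; intros eps He; rewrite Rplus_0_l.
destruct (Hk p Dp 1 Rlt_0_1) as [d [Hd0 Hkd]].
set (W := Cmod u + Cmod (u + h)).
assert (PW : 0 < W) by (unfold W; assert (X := Cmod_ge_0 (u + h)); lra).
set (M := Cmod (k p) + 1).
assert (PM : 0 < M) by (unfold M; assert (X := Cmod_ge_0 (k p)); lra).
(* The shrunken triangle has perimeter at most 2 s W. The second bound keeps it where [M] dominates
   [k], the third makes its integral at most [eps]. *)
set (s := Rmin 1 (Rmin (d / (2 * W)) (eps / (2 * W * M)))).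
assert (Ps : 0 < s).
{ unfold s; repeat apply Rmin_pos; [lra | |]; apply Rdiv_lt_0_compat; auto; nra. }
assert (S1 : s <= 1) by apply Rmin_l.
assert (S2 : s * (2 * W) <= d).
{ apply Rle_div_r; [lra|]; unfold s; eapply Rle_trans; [apply Rmin_r | apply Rmin_l]. }
assert (S3 : s * (2 * W * M) <= eps).
{ apply Rle_div_r; [nra|]; unfold s; eapply Rle_trans; [apply Rmin_r | apply Rmin_r]. }
rewrite (cut s) by lra.
set (a := (p + RtoC s * (z - p))%C); set (b := (p + RtoC s * (z + h - p))%C).
assert (Da : unit_disc a) by (apply unit_disc_convex; auto; lra).
assert (Db : unit_disc b) by (apply unit_disc_convex; auto; lra).
assert (Na : Cmod (a - p) = s * Cmod u).
{ replace (a - p)%C with (s * u)%C by (unfold a, u; ring).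
  rewrite Cmod_mult, Cmod_R, Rabs_pos_eq; lra. }
assert (Nb : Cmod (b - p) = s * Cmod (u + h)).
{ replace (b - p)%C with (s * (u + h))%C by (unfold b, u; ring).
  rewrite Cmod_mult, Cmod_R, Rabs_pos_eq; lra. }
assert (PsW : s * W < d) by nra.
assert (Puh := Cmod_ge_0 (u + h)).
assert (Bk : forall w, Cmod (w - p) <= s * W -> Cmod (k w) <= M).
{ intros w Hw; specialize (Hkd (w - p)%C ltac:(lra)).
  replace (p + (w - p))%C with w in Hkd by ring.
  assert (X := Cmod_minus_ge (k w) (k p)); unfold M; lra. }
assert (edge : forall x y, unit_disc x -> unit_disc y -> Cmod (x - p) <= s * W ->
  Cmod (y - p) <= s * W -> Cmod (seg_int k x y) <= Cmod (y - x) * M).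
{ intros x y Dx Dy Hx Hy; apply seg_int_bound; [now apply SC|]; intros t Ht.
  apply Bk.
  replace (x + t * (y - x) - p)%C with (x - p + t * ((y - p) - (x - p)))%C by ring.
  apply Rle_trans with (1 := Cmod_between _ _ t Ht); now apply Rmax_lub. }
assert (Np : Cmod (p - p) = 0) by (replace (p - p)%C with (RtoC 0) by ring; apply Cmod_0).
assert (E1 := edge p a Dp Da ltac:(rewrite Np; nra) ltac:(rewrite Na; unfold W; nra)).
assert (E2 := edge a b Da Db ltac:(rewrite Na; unfold W; nra) ltac:(rewrite Nb; unfold W; nra)).
assert (E3 := edge b p Db Dp ltac:(rewrite Nb; unfold W; nra) ltac:(rewrite Np; nra)).
rewrite (Cmod_minus_sym p b) in E3; rewrite Na in E1; rewrite Nb in E3.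
assert (Nab : Cmod (b - a) <= s * W).
{ replace (b - a)%C with ((b - p) - (a - p))%C by ring.
  apply Rle_trans with (1 := Cmod_minus_le _ _); rewrite Na, Nb; unfold W; lra. }
unfold tri_int; apply Rle_trans with (1 := Cmod_triangle3 _ _ _).
assert (Cmod (b - a) * M <= s * W * M) by (apply Rmult_le_compat_r; lra).
unfold W in *; lra.
Qed.

(** The primitive is the integral along the segment from the exceptional point itself. Every
    triangle that arises then has [p] as a vertex, which is the case settled by [goursat_vertex]; at
    [z = p] the triangle is degenerate. *)
Lemma disc_primitive (k : C -> C) (p : C) : unit_disc p ->
  (forall w, unit_disc w -> ccont k w) ->
  (forall w, unit_disc w -> w <> p -> exists l, cderiv k w l) ->
  exists K, forall z, unit_disc z -> cderiv K z (k z).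
Proof.
intros Dp Hk Hd; exists (seg_int k p); intros z Dz eps He.
assert (Pz : 0 < 1 - Cmod z) by (unfold unit_disc in Dz; lra).
destruct (seg_int_near k z (1 - Cmod z) Pz) with (eps := eps) as [d [Hd0 H]].
{ intros h Hh; now apply Hk, unit_disc_near. }
{ exact He. }
assert (main : exists r, 0 < r /\ forall h : C, Cmod h < r -> unit_disc (z + h)%C ->
  tri_int k p z (z + h) = 0).
{ destruct (Ceq_dec z p) as [->|Hn].
  - exists 1; split; [lra|]; intros h _ Dh; unfold tri_int.
    rewrite seg_int_same, (seg_int_swap k p (p + h)); [ring|].
    intros t Ht; now apply Hk, unit_disc_convex.
  - assert (X := proj1 (Cmod_gt_0 _) (Cminus_eq_contra _ _ Hn)).
    exists (Cmod (z - p) / 2); split; [lra|]; intros h Hh Dh.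
    apply goursat_vertex; auto; lra. }
destruct main as [r [Hr Hm]].
exists (Rmin r (Rmin (1 - Cmod z) d)); split; [repeat apply Rmin_pos; lra|].
intros h Hh; apply Rmin_Rgt in Hh; destruct Hh as [H1 Hh].
apply Rmin_Rgt in Hh; destruct Hh as [H2 H3].
assert (Dh : unit_disc (z + h)%C) by now apply unit_disc_near.
specialize (Hm h H1 Dh); unfold tri_int in Hm.
rewrite (seg_int_swap k p (z + h)) in Hm
  by (intros t Ht; now apply Hk, unit_disc_convex).
replace (seg_int k p (z + h) - seg_int k p z - k z * h)%C
  with (seg_int k z (z + h) - k z * h)%C; [now apply H|].
set (x1 := seg_int k p z) in *; set (x2 := seg_int k z (z + h)) in *.
set (x3 := seg_int k p (z + h)) in *.
replace x3 with (x1 + x2 - (x1 + x2 + - x3))%C by ring; rewrite Hm; ring.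
Qed.

(** * Cauchy expansions on circles *)

(** Real [t] trace the circle; the parameter is complex so that [cderiv] applies along it. *)
Definition circle (r : R) (t : C) : C := (RtoC r * Cexp (Ci * t))%C.

(** For real [t] this is the conjugate of the n-th power of e^(it). *)
Definition harmonic (n : nat) (t : C) : C := Cexp (- (RtoC (INR n) * Ci) * t).

(** The n-th Fourier coefficient of [f] on the circle of radius [r]; for holomorphic [f] it is a_n
    r^n with a_n the Taylor coefficient. *)
Definition circle_mean (f : C -> C) (r : R) (n : nat) : C :=
  (rint (fun t => f (circle r t) * harmonic n t) 0 (2 * PI) / RtoC (2 * PI))%C.

Lemma two_PI_neq_0 : RtoC (2 * PI) <> 0.
Proof. intros H; apply RtoC_inj in H; assert (X := PI_RGT_0); lra. Qed.

Lemma cderiv_Cexp_lin (c t : C) : cderiv (fun s => Cexp (c * s)) t (c * Cexp (c * t)).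
Proof.
eapply cderiv_eq.
- apply (cderiv_comp Cexp (fun s => c * s)%C); [apply cderiv_Cexp|].
  apply cderiv_scal, cderiv_id.
- ring.
Qed.

Lemma cderiv_circle (r : R) (t : C) : cderiv (circle r) t (Ci * circle r t).
Proof.
eapply cderiv_eq; [apply cderiv_scal, cderiv_Cexp_lin | unfold circle; ring].
Qed.

Lemma Cexp_i_2PI : Cexp (Ci * RtoC (2 * PI)) = 1.
Proof.
unfold Cexp, Ci, RtoC, Cmult; simpl.
replace (0 * (2 * PI) - 1 * 0) with 0 by ring.
replace (0 * 0 + 1 * (2 * PI)) with (2 * PI) by ring.
rewrite exp_0, cos_2PI, sin_2PI; f_equal; ring.
Qed.

Lemma harmonic_0 (t : C) : harmonic 0 t = 1.
Proof.
unfold harmonic; simpl INR; replace (- (0 * Ci) * t)%C with (RtoC 0) by ring.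
apply Cexp_0.
Qed.

Lemma harmonic_S (n : nat) (t : C) :
  (Cexp (Ci * t) * harmonic (S n) t)%C = harmonic n t.
Proof.
unfold harmonic; rewrite <- Cexp_plus, S_INR, RtoC_plus; f_equal; ring.
Qed.

Lemma harmonic_2PI (n : nat) : harmonic n (RtoC (2 * PI)) = 1.
Proof.
induction n as [|n IH]; [apply harmonic_0|].
rewrite <- IH, <- (harmonic_S n (RtoC (2 * PI))), Cexp_i_2PI; ring.
Qed.

Lemma Cmod_harmonic (n : nat) (t : R) : Cmod (harmonic n (RtoC t)) = 1.
Proof.
unfold harmonic; rewrite Cmod_Cexp.
replace (Re _) with 0; [apply exp_0|].
unfold Ci, RtoC, Cmult; simpl; ring.
Qed.

Lemma Cmod_circle (r t : R) : 0 <= r -> Cmod (circle r (RtoC t)) = r.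
Proof.
intros Hr; unfold circle; rewrite Cmod_mult, Cmod_R, Cmod_Cexp, Rabs_pos_eq by exact Hr.
replace (Re _) with 0; [rewrite exp_0; ring|].
unfold Ci, RtoC, Cmult; simpl; ring.
Qed.

Lemma ccont_harmonic (n : nat) (t : C) : ccont (harmonic n) t.
Proof. eapply cderiv_ccont, cderiv_Cexp_lin. Qed.

Lemma ccont_circle (r : R) (t : C) : ccont (circle r) t.
Proof. eapply cderiv_ccont, cderiv_circle. Qed.

Lemma rint_const_2PI (c : C) : rint (fun _ => c) 0 (2 * PI) = (RtoC (2 * PI) * c)%C.
Proof.
assert (X := PI_RGT_0).
rewrite (rint_derive (fun t => c * t)%C).
- ring.
- lra.
- intros t _; eapply cderiv_eq; [apply cderiv_scal, cderiv_id | ring].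
- intros t _; apply ccont_const.
Qed.

Lemma rint_harmonic (n : nat) : rint (harmonic (S n)) 0 (2 * PI) = 0.
Proof.
assert (X := PI_RGT_0).
set (c := (- (RtoC (INR (S n)) * Ci))%C).
assert (Hc : c <> 0).
{ unfold c; intros E; apply (f_equal Copp) in E.
  replace (- - (RtoC (INR (S n)) * Ci))%C with (RtoC (INR (S n)) * Ci)%C in E by ring.
  apply (Cmult_neq_0 (RtoC (INR (S n))) Ci); [| exact Ci_nz | rewrite E; ring].
  intros F; apply RtoC_inj in F; revert F; apply not_0_INR; lia. }
rewrite (rint_derive (fun t => / c * harmonic (S n) t)%C).
- rewrite harmonic_2PI; unfold harmonic.
  replace (- (RtoC (INR (S n)) * Ci) * RtoC 0)%C with (RtoC 0) by ring.
  rewrite Cexp_0; ring.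
- lra.
- intros t _; eapply cderiv_eq; [apply cderiv_scal, cderiv_Cexp_lin|].
  fold c; unfold harmonic; fold c; field; exact Hc.
- intros t _; apply ccont_harmonic.
Qed.

(** Up to the factor -i, the integrand is the derivative of [K] along a closed curve. *)
Lemma circle_integral_primitive (K k : C -> C) (r : R) : 0 <= r ->
  (forall t, cderiv K (circle r (RtoC t)) (k (circle r (RtoC t)))) ->
  (forall t, ccont k (circle r (RtoC t))) ->
  rint (fun t => k (circle r t) * circle r t)%C 0 (2 * PI) = 0.
Proof.
intros Hr HK Hk; assert (X := PI_RGT_0).
rewrite (rint_derive (fun t => - Ci * K (circle r t))%C).
- unfold circle; rewrite Cexp_i_2PI.
  replace (Ci * RtoC 0)%C with (RtoC 0) by ring; rewrite Cexp_0; ring.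
- lra.
- intros t _; eapply cderiv_eq.
  + apply cderiv_scal, (cderiv_comp K (circle r)); [apply HK | apply cderiv_circle].
  + replace (- Ci * (k (circle r t) * (Ci * circle r t)))%C
      with (- (Ci * Ci) * (k (circle r t) * circle r t))%C by ring.
    replace (Ci * Ci)%C with (- (1))%C; [ring|].
    unfold Ci, Cmult, RtoC, Copp; simpl; f_equal; ring.
- intros t _; apply ccont_mult; [|apply ccont_circle].
  apply (ccont_comp k (circle r)); [apply Hk | apply ccont_circle].
Qed.

(** The sum stops before index [n], so that inductions start from the empty sum; [sum_n] at [n]
    corresponds to [partial_sum] at [S n]. *)
Fixpoint partial_sum (a : nat -> C) (z : C) (n : nat) : C :=
  match n with O => RtoC 0 | S m => (partial_sum a z m + a m * z ^ m)%C end.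

Definition psum (a : nat -> C) (z l : C) : Prop :=
  forall eps, 0 < eps -> exists N, forall n, (N <= n)%nat ->
    Cmod (partial_sum a z n - l) < eps.

Lemma sum_n_partial_sum (a : nat -> C) (z : C) (n : nat) :
  sum_n (G := C_AbelianMonoid) (fun k => scal (V := C_NormedModule) (pow_n (K := C_Ring) z k) (a k)) n
  = partial_sum a z (S n).
Proof.
assert (P : forall k, pow_n (K := C_Ring) z k = (z ^ k)%C).
{ induction k as [|k IH]; [reflexivity|].
  simpl; rewrite IH; reflexivity. }
assert (T : forall k, scal (V := C_NormedModule) (pow_n (K := C_Ring) z k) (a k)
  = (a k * z ^ k)%C).
{ intros k; rewrite P; apply Cmult_comm. }
induction n as [|n IH].
- unfold sum_n; rewrite sum_n_n, T; simpl; ring.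
- unfold sum_n in *; rewrite sum_n_Sm, IH, T by lia; reflexivity.
Qed.

Lemma psum_is_pseries (a : nat -> C) (z l : C) :
  psum a z l <-> is_pseries (K := C_AbsRing) (V := C_NormedModule) a z l.
Proof.
unfold is_pseries, is_series.
split.
- intros H; apply (filterlim_locally_ball_norm (U := C_NormedModule)); intros eps.
  destruct (H eps (cond_pos eps)) as [N HN]; exists N; intros n Hn.
  assert (X := HN (S n) ltac:(lia)); rewrite <- sum_n_partial_sum in X; exact X.
- intros H eps He.
  destruct (proj1 (filterlim_locally_ball_norm (U := C_NormedModule) _ _) H
    (mkposreal eps He)) as [N HN].
  exists (S N); intros n Hn; destruct n as [|n]; [lia|].
  rewrite <- sum_n_partial_sum; apply HN; lia.
Qed.

(** The value at [z] is a parameter, so that a known derivative can be inserted without rewriting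
    [C_derive]. *)
Definition quot (f : C -> C) (z l : C) (w : C) : C :=
  if Ceq_dec w z then l else ((f w - f z) / (w - z))%C.

Lemma quot_ccont (f : C -> C) (z l : C) : cderiv f z l -> ccont (quot f z l) z.
Proof.
intros Hf eps He; destruct (Hf (eps / 2)) as [d [Hd H]]; [lra|].
exists d; split; [exact Hd|]; intros h Hh; specialize (H h Hh).
unfold quot; destruct (Ceq_dec z z) as [_|n]; [|now destruct n].
destruct (Ceq_dec (z + h)%C z) as [E|E].
- replace (l - l)%C with (RtoC 0) by ring; rewrite Cmod_0; exact He.
- assert (Hn : h <> 0) by (intros ->; apply E; ring).
  assert (Pn := proj1 (Cmod_gt_0 h) Hn).
  replace (z + h - z)%C with h by ring.
  replace ((f (z + h) - f z) / h - l)%C with ((f (z + h) - f z - l * h) / h)%C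
    by (field; exact Hn).
  rewrite Cmod_div by exact Hn; apply Rlt_div_l; [lra|]; nra.
Qed.

Lemma quot_cderiv (f : C -> C) (z l w m : C) : w <> z -> cderiv f w m ->
  exists q, cderiv (quot f z l) w q.
Proof.
intros Hw Hf; eexists.
assert (Pw := proj1 (Cmod_gt_0 _) (Cminus_eq_contra _ _ Hw)).
apply cderiv_ext_near with (fun v => (f v - f z) / (v - z))%C (Cmod (w - z)).
- exact Pw.
- intros h Hh; unfold quot; destruct (Ceq_dec (w + h)%C z) as [E|E]; [|reflexivity].
  exfalso; rewrite <- E in Hh; replace (w - (w + h))%C with (- h)%C in Hh by ring.
  rewrite Cmod_opp in Hh; lra.
- apply cderiv_div; [now apply Cminus_eq_contra | |];
  (apply cderiv_minus; [eassumption || apply cderiv_id | apply cderiv_const]).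
Qed.

(** Continuity at [z] and differentiability elsewhere are what [disc_primitive] asks for, with [z]
    as the exceptional point. *)
Lemma disc_quot (f : C -> C) (z : C) : holomorphic_on unit_disc f -> unit_disc z ->
  (forall w, unit_disc w -> ccont (quot f z (C_derive f z)) w) /\
  exists K, forall w, unit_disc w -> cderiv K w (quot f z (C_derive f z) w).
Proof.
intros Hf Dz.
assert (Hd : forall w, unit_disc w -> w <> z ->
  exists l, cderiv (quot f z (C_derive f z)) w l).
{ intros w Dw Hw; eapply quot_cderiv; [exact Hw | now apply holomorphic_cderiv with unit_disc]. }
assert (Hc : forall w, unit_disc w -> ccont (quot f z (C_derive f z)) w).
{ intros w Dw; destruct (Ceq_dec w z) as [->|n].
  - apply quot_ccont; now apply holomorphic_cderiv with unit_disc.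
  - destruct (Hd w Dw n) as [l Hl]; now apply cderiv_ccont in Hl. }
split; [exact Hc|]; now apply disc_primitive with z.
Qed.

Lemma cont_bounded (f : C -> C) (a b : R) : a <= b -> cont_on f a b ->
  exists M, forall t, a <= t <= b -> Cmod (f (RtoC t)) <= M.
Proof.
intros Hab Hf.
destruct (continuity_ab_maj (fun t => Cmod (f (RtoC t))) a b Hab) as [x [Hx _]].
- intros t Ht; apply continuity_pt_filterlim.
  apply (filterlim_locally_ball_norm (U := R_NormedModule)); intros eps.
  destruct (Hf t Ht eps (cond_pos eps)) as [d [Hd H]].
  exists (mkposreal d Hd); intros s Hs.
  assert (Hm : Cmod (RtoC (s - t)) < d) by (rewrite Cmod_R; exact Hs).
  specialize (H _ Hm); rewrite RtoC_minus in H.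
  replace (t + (s - t))%C with (RtoC s) in H by ring.
  change (Rabs (Cmod (f s) - Cmod (f t)) < eps).
  assert (X := Cmod_minus_ge (f s) (f t)); assert (Y := Cmod_minus_ge (f t) (f s)).
  rewrite Cmod_minus_sym in Y; apply Rabs_lt_between; lra.
- exists (Cmod (f (RtoC x))); exact Hx.
Qed.

Lemma circle_disc (r t : R) : 0 <= r < 1 -> unit_disc (circle r (RtoC t)).
Proof. intros Hr; unfold unit_disc; rewrite Cmod_circle; lra. Qed.

Lemma holomorphic_ccont (f : C -> C) (z : C) :
  holomorphic_on unit_disc f -> unit_disc z -> ccont f z.
Proof. intros Hf Dz; eapply cderiv_ccont, holomorphic_cderiv; eauto. Qed.

Lemma ccont_on_circle (f : C -> C) (r t : R) : holomorphic_on unit_disc f ->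
  0 <= r < 1 -> ccont (fun s => f (circle r s)) (RtoC t).
Proof.
intros Hf Hr; apply (ccont_comp f (circle r)); [|apply ccont_circle].
apply holomorphic_ccont; [exact Hf | now apply circle_disc].
Qed.

Lemma circle_neq (r t : R) (z : C) : Cmod z < r -> circle r (RtoC t) <> z.
Proof.
intros Hz E; assert (X := Cmod_circle r t).
assert (Y := Cmod_ge_0 z); rewrite E in X; specialize (X ltac:(lra)); lra.
Qed.

(** With s = [circle r t], the factor [(z / r) ^ N * harmonic N t] is (z/s)^N, and each induction
    step peels one Taylor term off the vanishing integral of the case N = 0. The value [f z] enters
    multiplied by the mean of (z/s)^N, which is 1 for N = 0 and 0 afterwards; hence the case
    distinction. *)
Lemma cauchy_remainder (f : C -> C) (z : C) (r : R) :
  holomorphic_on unit_disc f -> Cmod z < r < 1 ->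
  forall N, rint (fun t => (quot f z (C_derive f z) (circle r t) * circle r t) *
      ((z / r) ^ N * harmonic N t))%C 0 (2 * PI)
    = (RtoC (2 * PI) * ((if N then 0 else f z)
       - partial_sum (fun n => circle_mean f r n / RtoC r ^ n) z N))%C.
Proof.
intros Hf Hr; assert (P := PI_RGT_0); assert (Pz := Cmod_ge_0 z).
assert (Hr0 : 0 <= r < 1) by lra.
assert (Dz : unit_disc z) by (unfold unit_disc; lra).
assert (rn : RtoC r <> 0) by (intros E; apply RtoC_inj in E; lra).
destruct (disc_quot f z Hf Dz) as [Hc [K HK]].
set (k := quot f z (C_derive f z)) in *.
assert (Ck : forall t : R, ccont (fun s => k (circle r s) * circle r s)%C t).
{ intros t; apply ccont_mult; [|apply ccont_circle].
  apply (ccont_comp k (circle r)); [apply Hc; now apply circle_disc | apply ccont_circle]. }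
assert (Ch : forall (c : C) n t, ccont (fun s => c * harmonic n s)%C t).
{ intros c n t; apply ccont_mult; [apply ccont_const | apply ccont_harmonic]. }
induction N as [|N IH].
- simpl partial_sum; replace (RtoC (2 * PI) * (0 - 0))%C with (RtoC 0) by ring.
  rewrite <- (circle_integral_primitive K k r ltac:(lra)).
  + apply rint_ext; [lra|]; intros t _; rewrite harmonic_0; simpl; ring.
  + intros t; now apply HK, circle_disc.
  + intros t; now apply Hc, circle_disc.
- (* [k(s) s = (f s - f z) + (k(s) s) (z / s)] on the circle *)
  assert (E : rint (fun t => (k (circle r t) * circle r t) *
      ((z / r) ^ N * harmonic N t))%C 0 (2 * PI) =
    ((z / r) ^ N * rint (fun t => f (circle r t) * harmonic N t) 0 (2 * PI)
     + (- (z / r) ^ N * f z) * rint (harmonic N) 0 (2 * PI)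
     + rint (fun t => (k (circle r t) * circle r t) *
      ((z / r) ^ S N * harmonic (S N) t)) 0 (2 * PI))%C).
  { assert (C1 : cont_on (fun t => f (circle r t) * harmonic N t)%C 0 (2 * PI)).
    { intros t _; apply ccont_mult; [now apply ccont_on_circle | apply ccont_harmonic]. }
    assert (C2 : cont_on (harmonic N) 0 (2 * PI)) by (intros t _; apply ccont_harmonic).
    rewrite <- !rint_scal by (lra || assumption).
    rewrite <- !rint_plus; try lra.
    - apply rint_ext; [lra|]; intros t _.
      rewrite <- (harmonic_S N t), Cpow_S.
      set (q := ((z / r) ^ N)%C); set (hN := harmonic (S N) t).
      assert (Hn := circle_neq r t z (proj1 Hr)).
      unfold k, quot; destruct (Ceq_dec (circle r t) z) as [e|_]; [now destruct Hn|].
      set (fs := f (circle r t)); unfold circle in *.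
      set (s := Cexp (Ci * t)) in *.
      field; split; [exact rn|].
      now apply Cminus_eq_contra.
    - intros t Ht; apply ccont_plus; [|apply Ch].
      apply ccont_mult; [apply ccont_const | now apply C1].
    - intros t _; apply (ccont_mult (fun t => k (circle r t) * circle r t)%C);
        [apply Ck | apply Ch].
    - intros t Ht; apply ccont_mult; [apply ccont_const | now apply C1].
    - intros t _; apply Ch. }
  rewrite IH in E.
  set (J := rint (fun t => (k (circle r t) * circle r t) *
      ((z / r) ^ S N * harmonic (S N) t))%C 0 (2 * PI)) in *.
  assert (M : rint (fun t => f (circle r t) * harmonic N t)%C 0 (2 * PI)
    = (RtoC (2 * PI) * circle_mean f r N)%C).
  { unfold circle_mean; field; apply two_PI_neq_0. }
  rewrite M in E.
  assert (Q : ((z / r) ^ N = z ^ N / RtoC r ^ N)%C).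
  { unfold Cdiv; rewrite Cpow_mult_l, Cpow_inv by exact rn; reflexivity. }
  rewrite Q in E; simpl partial_sum.
  assert (F : forall x y j : C, x = (y + j)%C -> j = (x - y)%C) by (intros x y j ->; ring).
  apply F in E; rewrite E.
  assert (rN : (RtoC r ^ N)%C <> 0) by now apply Cpow_nz.
  destruct N as [|N].
  + replace (rint (harmonic 0) 0 (2 * PI)) with (RtoC (2 * PI) * 1)%C.
    2: { rewrite <- rint_const_2PI; apply rint_ext; [lra|]; intros t _.
         symmetry; apply harmonic_0. }
    simpl; field; exact C1_nz.
  + rewrite rint_harmonic; field; exact rN.
Qed.

(** The difference quotient is bounded on the circle, where |z/s| = |z|/r < 1. The index starts at
    [S N] because [f z] is absent from [cauchy_remainder] at 0. *)
Lemma cauchy_expansion_bound (f : C -> C) (z : C) (r : R) :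
  holomorphic_on unit_disc f -> Cmod z < r < 1 -> exists M, forall N,
    Cmod (f z - partial_sum (fun n => circle_mean f r n / RtoC r ^ n)%C z (S N))
    <= M * (Cmod z / r) ^ S N.
Proof.
intros Hf Hr; assert (P := PI_RGT_0); assert (Pz := Cmod_ge_0 z).
assert (Hr0 : 0 <= r < 1) by lra.
assert (Dz : unit_disc z) by (unfold unit_disc; lra).
assert (rn : RtoC r <> 0) by (intros E; apply RtoC_inj in E; lra).
destruct (disc_quot f z Hf Dz) as [Hc _].
assert (Ck : cont_on (fun s => quot f z (C_derive f z) (circle r s) * circle r s)%C 0 (2 * PI)).
{ intros t _; apply ccont_mult; [|apply ccont_circle].
  apply (ccont_comp (quot f z (C_derive f z)) (circle r)); [|apply ccont_circle].
  now apply Hc, circle_disc. }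
destruct (cont_bounded _ 0 (2 * PI) ltac:(lra) Ck) as [M HM].
exists M; intros N.
assert (R := cauchy_remainder f z r Hf Hr (S N)).
set (X := (f z - partial_sum (fun n => circle_mean f r n / RtoC r ^ n) z (S N))%C) in *.
assert (B : Cmod (RtoC (2 * PI) * X) <= (2 * PI - 0) * (M * (Cmod z / r) ^ S N)).
{ rewrite <- R; apply Cmod_rint_le_const; [lra | |].
  - intros t Ht; apply ccont_mult; [now apply Ck|].
    apply ccont_mult; [apply ccont_const | apply ccont_harmonic].
  - intros t Ht; rewrite Cmod_mult, (Cmod_mult ((z / r) ^ S N)%C), Cmod_harmonic, Rmult_1_r.
    rewrite Cmod_pow, Cmod_div, Cmod_R, (Rabs_pos_eq r) by (exact rn || lra).
    apply Rmult_le_compat_r; [|now apply HM].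
    apply pow_le, Rdiv_le_0_compat; lra. }
rewrite Cmod_mult, Cmod_R, Rabs_pos_eq in B by lra.
rewrite Rminus_0_r in B; apply Rmult_le_reg_l in B; [exact B | lra].
Qed.

Lemma cauchy_expansion (f : C -> C) (z : C) (r : R) :
  holomorphic_on unit_disc f -> Cmod z < r < 1 ->
  psum (fun n => circle_mean f r n / RtoC r ^ n)%C z (f z).
Proof.
intros Hf Hr eps He.
destruct (cauchy_expansion_bound f z r Hf Hr) as [M HM].
assert (Pz := Cmod_ge_0 z).
assert (q0 : 0 <= Cmod z / r) by (apply Rdiv_le_0_compat; lra).
destruct (pow_lt_1_zero (Cmod z / r)) with (y := eps / (Rabs M + 1)) as [N HN].
{ rewrite Rabs_pos_eq by exact q0; apply Rlt_div_l; lra. }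
{ apply Rdiv_lt_0_compat; [exact He|]; assert (X := Rabs_pos M); lra. }
exists (S N); intros [|n] Hn; [lia|].
rewrite Cmod_minus_sym; apply Rle_lt_trans with (1 := HM n).
specialize (HN (S n) ltac:(lia)).
assert (Q : 0 <= (Cmod z / r) ^ S n) by now apply pow_le.
rewrite Rabs_pos_eq in HN by exact Q; assert (X := Rabs_pos M).
apply Rlt_div_r in HN; [|lra]; assert (Y := Rle_abs M); nra.
Qed.

(** * Power series and expansions at the origin *)

(** From some index on, a term is the difference of two partial sums lying within 1 of the limit;
    finitely many terms remain. *)
Lemma psum_term_bounded (a : nat -> C) (z l : C) : psum a z l ->
  exists B, forall n, Cmod (a n) * Cmod z ^ n <= B.
Proof.
intros H; destruct (H 1 Rlt_0_1) as [N HN].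
assert (fin : forall m, exists B, forall n, (n < m)%nat -> Cmod (a n) * Cmod z ^ n <= B).
{ induction m as [|m [B HB]]; [exists 0; intros; lia|].
  exists (Rmax B (Cmod (a m) * Cmod z ^ m)); intros n Hn.
  destruct (Nat.eq_dec n m) as [->|E]; [apply Rmax_r|].
  apply Rle_trans with (2 := Rmax_l _ _), HB; lia. }
destruct (fin N) as [B HB]; exists (Rmax B 2); intros n.
destruct (Nat.lt_ge_cases n N) as [L|L].
- apply Rle_trans with (2 := Rmax_l _ _); now apply HB.
- apply Rle_trans with (2 := Rmax_r _ _); rewrite <- Cmod_pow, <- Cmod_mult.
  assert (H1 := HN n L); assert (H2 := HN (S n) ltac:(lia)); simpl in H2.
  replace (a n * z ^ n)%C
    with ((partial_sum a z n + a n * z ^ n - l) - (partial_sum a z n - l))%C by ring.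
  apply Rle_trans with (1 := Cmod_minus_le _ _); lra.
Qed.

(** Comparison with a geometric series of ratio at most 1/2, whose sum is the factor 2. The finite
    version [T] carries the exact sum 2 (1 - 2^(-m)) so that the induction closes. *)
Lemma psum_tail (a : nat -> C) (z l : C) (s B : R) : 0 < s -> psum a z l ->
  (forall n, Cmod (a n) * s ^ n <= B) -> Cmod z <= s / 2 ->
  forall n, Cmod (l - partial_sum a z n) <= 2 * B * (Cmod z / s) ^ n.
Proof.
intros Hs H HB Hz n.
assert (Pz := Cmod_ge_0 z).
assert (PB : 0 <= B).
{ apply Rle_trans with (2 := HB O), Rmult_le_pos; [apply Cmod_ge_0 | apply pow_le; lra]. }
set (q := Cmod z / s).
assert (Hq : 0 <= q <= / 2).
{ unfold q; split; [apply Rdiv_le_0_compat; lra | apply Rle_div_l; lra]. }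
assert (qn : 0 <= q ^ n) by (apply pow_le; lra).
assert (T : forall m, Cmod (partial_sum a z (n + m) - partial_sum a z n)
  <= B * q ^ n * (2 * (1 - (/ 2) ^ m))).
{ induction m as [|m IH].
  - rewrite Nat.add_0_r.
    replace (partial_sum a z n - partial_sum a z n)%C with (RtoC 0) by ring.
    rewrite Cmod_0; simpl; lra.
  - rewrite Nat.add_succ_r; simpl partial_sum.
    replace (partial_sum a z (n + m) + a (n + m)%nat * z ^ (n + m) - partial_sum a z n)%C
      with ((partial_sum a z (n + m) - partial_sum a z n) + a (n + m)%nat * z ^ (n + m))%C
      by ring.
    apply Rle_trans with (1 := Cmod_triangle _ _); rewrite Cmod_mult, Cmod_pow.
    assert (E : Cmod (a (n + m)%nat) * Cmod z ^ (n + m)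
      = Cmod (a (n + m)%nat) * s ^ (n + m) * q ^ (n + m)).
    { replace (Cmod z) with (s * q) by (unfold q; field; lra).
      rewrite Rpow_mult_distr; ring. }
    assert (E2 : Cmod (a (n + m)%nat) * Cmod z ^ (n + m) <= B * (q ^ n * (/ 2) ^ m)).
    { rewrite E, pow_add with (x := q).
      apply Rmult_le_compat; [|apply Rmult_le_pos; apply pow_le; lra | apply HB|].
      - apply Rmult_le_pos; [apply Cmod_ge_0 | apply pow_le; lra].
      - apply Rmult_le_compat_l; [exact qn | apply pow_incr; exact Hq]. }
    simpl pow; lra. }
apply le_epsilon; intros eps He; destruct (H eps He) as [N HN].
specialize (HN (n + N)%nat ltac:(lia)); specialize (T N).
replace (l - partial_sum a z n)%C
  with ((partial_sum a z (n + N) - partial_sum a z n) - (partial_sum a z (n + N) - l))%C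
  by ring.
apply Rle_trans with (1 := Cmod_minus_le _ _).
assert (0 <= (/ 2) ^ N) by (apply pow_le; lra).
assert (0 <= B * q ^ n) by now apply Rmult_le_pos.
nra.
Qed.

(** * Bounded remainders and jets at the origin *)

Definition near0 (P : C -> Prop) : Prop :=
  exists d, 0 < d /\ forall z, Cmod z < d -> P z.

Lemma near0_and (P Q : C -> Prop) : near0 P -> near0 Q -> near0 (fun z => P z /\ Q z).
Proof.
intros [d [Hd HP]] [e [He HQ]]; exists (Rmin d e); split; [now apply Rmin_pos|].
intros z Hz; apply Rmin_Rgt in Hz; destruct Hz; split; auto.
Qed.

Lemma near0_imp (P Q : C -> Prop) : (forall z, P z -> Q z) -> near0 P -> near0 Q.
Proof. intros H [d [Hd HP]]; exists d; split; auto. Qed.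

Lemma near0_disc (P : C -> Prop) : (forall z, unit_disc z -> P z) -> near0 P.
Proof. intros H; exists 1; split; [lra | exact H]. Qed.

(** Landau's O(1): an error O(z^n) is written [z ^ n * R z] with [bounded0 R]. Explicit remainders
    turn the algebra of expansions into [ring] identities. *)
Definition bounded0 (f : C -> C) : Prop := exists M, 0 <= M /\ near0 (fun z => Cmod (f z) <= M).

Lemma bounded0_const (c : C) : bounded0 (fun _ => c).
Proof.
exists (Cmod c); split; [apply Cmod_ge_0|]; apply near0_disc; intros; apply Rle_refl.
Qed.

Lemma bounded0_id : bounded0 (fun z => z).
Proof.
exists 1; split; [lra|]; apply near0_disc; intros z Hz; unfold unit_disc in Hz; lra.
Qed.

Lemma bounded0_plus (f g : C -> C) :
  bounded0 f -> bounded0 g -> bounded0 (fun z => f z + g z)%C.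
Proof.
intros [M [PM HM]] [N [PN HN]]; exists (M + N); split; [lra|].
apply near0_imp with (2 := near0_and _ _ HM HN); intros z [H1 H2].
apply Rle_trans with (1 := Cmod_triangle _ _); lra.
Qed.

Lemma bounded0_mult (f g : C -> C) :
  bounded0 f -> bounded0 g -> bounded0 (fun z => f z * g z)%C.
Proof.
intros [M [PM HM]] [N [PN HN]]; exists (M * N); split; [now apply Rmult_le_pos|].
apply near0_imp with (2 := near0_and _ _ HM HN); intros z [H1 H2].
rewrite Cmod_mult; apply Rmult_le_compat; auto using Cmod_ge_0.
Qed.

Lemma bounded0_small (f : C -> C) : bounded0 f -> forall d, 0 < d ->
  near0 (fun z => Cmod (z * f z) < d).
Proof.
intros [M [PM [e [He HM]]]] d Hd.
exists (Rmin e (d / (M + 1))); split; [apply Rmin_pos; [lra | apply Rdiv_lt_0_compat; lra]|].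
intros z Hz; apply Rmin_Rgt in Hz; destruct Hz as [H1 H2].
apply Rlt_div_r in H2; [|lra]; specialize (HM z H1).
rewrite Cmod_mult; assert (X := Cmod_ge_0 z); nra.
Qed.

(** The inner function has the form [z * f z] so that it tends to 0 and ends up in the neighbourhood
    where [P] holds. *)
Lemma near0_comp (P : C -> Prop) (f : C -> C) : near0 P -> bounded0 f ->
  near0 (fun z => P (z * f z)%C).
Proof.
intros [d [Hd HP]] Hf; apply near0_imp with (2 := bounded0_small f Hf d Hd); auto.
Qed.

Lemma bounded0_comp (g f : C -> C) : bounded0 g -> bounded0 f ->
  bounded0 (fun z => g (z * f z)%C).
Proof. intros [M [PM HM]] Hf; exists M; split; [exact PM|]; now apply near0_comp with (1 := HM). Qed.

(** The device by which coefficients are compared: a constant that is O(z) vanishes. The point 0 is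
    left out because the equation usually comes from a division by a power of [z]. *)
Lemma near0_constant_zero (c : C) (f : C -> C) : bounded0 f ->
  near0 (fun z => z <> 0 -> c = (z * f z)%C) -> c = 0.
Proof.
intros Hf Hc; apply Cmod_eq_0, Rle_antisym; [|apply Cmod_ge_0].
apply le_epsilon; intros eps He; rewrite Rplus_0_l.
destruct (near0_and _ _ Hc (bounded0_small f Hf eps He)) as [d [Hd H]].
assert (X : Cmod (RtoC (d / 2)) < d) by (rewrite Cmod_R, Rabs_pos_eq; lra).
destruct (H _ X) as [H1 H2].
rewrite H1; [now apply Rlt_le|]; intros E; apply RtoC_inj in E; lra.
Qed.

Lemma psum_expansion (a : nat -> C) (f : C -> C) :
  near0 (fun z => psum a z (f z)) -> forall n, exists R, bounded0 R /\
    near0 (fun z => f z = (partial_sum a z (S n) + z ^ S n * R z)%C).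
Proof.
intros [d [Hd H]] n.
set (s := d / 2).
assert (Ps : 0 < s) by (unfold s; lra).
assert (Ms : Cmod (RtoC s) = s) by (rewrite Cmod_R; apply Rabs_pos_eq; lra).
destruct (psum_term_bounded a (RtoC s) _ (H (RtoC s) ltac:(rewrite Ms; unfold s; lra)))
  as [B HB]; rewrite Ms in HB.
assert (T : forall z, Cmod z < s / 2 -> forall n,
  Cmod (f z - partial_sum a z n) <= 2 * B * (Cmod z / s) ^ n).
{ intros z Hz; apply psum_tail; auto; [apply H; unfold s in *; lra | lra]. }
(* In the expansion the value at 0 is multiplied by 0; there the claim amounts to [f 0 = a 0], which
   the tail bound [T] supplies. *)
exists (fun z => if Ceq_dec z 0 then RtoC 0 else ((f z - partial_sum a z (S n)) / z ^ S n)%C).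
assert (PB : 0 <= B).
{ apply Rle_trans with (2 := HB O), Rmult_le_pos; [apply Cmod_ge_0 | apply pow_le; lra]. }
assert (Pn : 0 < s ^ S n) by now apply pow_lt.
split.
- exists (2 * B / s ^ S n); split; [apply Rdiv_le_0_compat; lra|].
  exists (s / 2); split; [lra|]; intros z Hz; destruct (Ceq_dec z 0) as [->|E].
  + rewrite Cmod_0; apply Rdiv_le_0_compat; lra.
  + assert (zn := Cpow_nz z (S n) E).
    rewrite Cmod_div, Cmod_pow by exact zn.
    assert (Pz : 0 < Cmod z ^ S n) by (apply pow_lt, Cmod_gt_0, E).
    apply Rle_div_l; [exact Pz|]; apply Rle_trans with (1 := T z Hz (S n)).
    unfold Rdiv; rewrite Rpow_mult_distr, pow_inv; right; ring.
- exists (s / 2); split; [lra|]; intros z Hz; destruct (Ceq_dec z 0) as [->|E].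
  + assert (Z : forall m, partial_sum a 0 (S m) = a O).
    { induction m as [|m IH]; [simpl; ring|].
      change (partial_sum a 0 (S (S m))) with (partial_sum a 0 (S m) + a (S m) * 0 ^ S m)%C.
      rewrite IH, Cpow_S; ring. }
    rewrite Z, Cmult_0_r, Cplus_0_r; apply Ceq_minus, Cmod_eq_0, Rle_antisym;
      [|apply Cmod_ge_0].
    rewrite <- (Z O); apply Rle_trans with (1 := T 0%C Hz 1%nat).
    rewrite Cmod_0; simpl; unfold Rdiv; lra.
  + field; now apply Cpow_nz.
Qed.

Lemma psum_unique (a b : nat -> C) (f : C -> C) :
  near0 (fun z => psum a z (f z)) -> near0 (fun z => psum b z (f z)) ->
  forall n, a n = b n.
Proof.
intros Ha Hb n; induction n as [n IH] using lt_wf_ind.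
assert (E : forall z m, (m <= n)%nat -> partial_sum a z m = partial_sum b z m).
{ intros z; induction m as [|m IHm]; intros Hm; [reflexivity|].
  simpl; rewrite IHm, IH by lia; reflexivity. }
destruct (psum_expansion a f Ha n) as [R [BR ER]].
destruct (psum_expansion b f Hb n) as [Q [BQ EQ]].
apply Ceq_minus; apply near0_constant_zero with (fun z => Q z + (- (1)) * R z)%C.
- apply bounded0_plus; [exact BQ|]; apply bounded0_mult; [apply bounded0_const | exact BR].
- apply near0_imp with (2 := near0_and _ _ ER EQ); intros z [H1 H2] Hz.
  rewrite H1 in H2; simpl partial_sum in H2; rewrite (E z n (le_n _)) in H2.
  assert (zn := Cpow_nz z n Hz).
  set (P := partial_sum b z n) in *; rewrite !Cpow_S in H2.
  replace (a n - b n)%C with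
    (((P + a n * z ^ n + z * z ^ n * R z) - (P + b n * z ^ n + z * z ^ n * Q z)
      + z * z ^ n * (Q z - R z)) / z ^ n)%C by (field; exact zn).
  rewrite H2; field; exact zn.
Qed.

(** Each radius [r] gives its own coefficients, valid for |z| < r. Uniqueness near 0 identifies them
    all with those of radius 1/2, and a radius beyond |z| then gives convergence at [z]. *)
Lemma holomorphic_psum (f : C -> C) : holomorphic_on unit_disc f ->
  exists a, (forall z, unit_disc z -> psum a z (f z)) /\
    (forall r n, 0 < r < 1 -> circle_mean f r n = (a n * RtoC r ^ n)%C).
Proof.
intros Hf.
set (a := fun r n => (circle_mean f r n / RtoC r ^ n)%C).
assert (H : forall r, 0 < r < 1 -> near0 (fun z => psum (a r) z (f z))).
{ intros r Hr; exists r; split; [lra|]; intros z Hz; apply cauchy_expansion; auto; lra. }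
assert (U : forall r n, 0 < r < 1 -> a (/ 2) n = a r n).
{ intros r n Hr; apply psum_unique with f; apply H; lra. }
exists (a (/ 2)); split.
- intros z Dz; unfold unit_disc in Dz.
  set (r := (Cmod z + 1) / 2); assert (Pz := Cmod_ge_0 z).
  assert (Hr : Cmod z < r < 1) by (unfold r; lra).
  assert (X := cauchy_expansion f z r Hf Hr).
  intros eps He; destruct (X eps He) as [N HN]; exists N; intros n Hn.
  replace (partial_sum (a (/ 2)) z n) with (partial_sum (a r) z n); [now apply HN|].
  clear Hn; induction n as [|n IH]; [reflexivity|].
  simpl; rewrite IH, (U r n) by lra; reflexivity.
- intros r n Hr; rewrite (U r n Hr); unfold a; field.
  apply Cpow_nz; intros E; apply RtoC_inj in E; lra.
Qed.

Lemma first_order_cderiv (f R : C -> C) (a0 a1 : C) : bounded0 R ->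
  near0 (fun z => f z = (a0 + a1 * z + z ^ 2 * R z)%C) -> cderiv f 0 a1.
Proof.
intros HR H eps He.
destruct (near0_and _ _ H (bounded0_small R HR eps He)) as [d [Hd K]].
exists d; split; [exact Hd|]; intros h Hh; destruct (K h Hh) as [K1 K2].
destruct (K 0%C ltac:(rewrite Cmod_0; exact Hd)) as [K0 _].
rewrite Cplus_0_l, K0, K1.
replace (_ - _ - _)%C with (h * R h * h)%C by ring.
rewrite Cmod_mult; apply Rmult_le_compat_r; [apply Cmod_ge_0 | lra].
Qed.

Lemma psum_cderiv_0 (a : nat -> C) (f : C -> C) :
  near0 (fun z => psum a z (f z)) -> f 0 = a O /\ cderiv f 0 (a 1%nat).
Proof.
intros H; destruct (psum_expansion a f H 1) as [R [HR E]]; split.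
- destruct E as [d [Hd E]]; rewrite (E 0%C) by (rewrite Cmod_0; exact Hd); simpl; ring.
- apply (first_order_cderiv f R (a O)); [exact HR|].
  apply near0_imp with (2 := E); intros z ->; simpl; ring.
Qed.

Lemma Cmod_circle_mean (f : C -> C) (r M : R) (n : nat) : holomorphic_on unit_disc f ->
  0 <= r < 1 -> (forall z, unit_disc z -> Cmod (f z) <= M) -> Cmod (circle_mean f r n) <= M.
Proof.
intros Hf Hr HM; assert (P := PI_RGT_0).
unfold circle_mean; rewrite Cmod_div by apply two_PI_neq_0.
rewrite Cmod_R, Rabs_pos_eq by lra; apply Rle_div_l; [lra|].
replace (M * (2 * PI)) with ((2 * PI - 0) * M) by ring.
apply Cmod_rint_le_const; [lra | |].
- intros t _; apply ccont_mult; [now apply ccont_on_circle | apply ccont_harmonic].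
- intros t _; rewrite Cmod_mult, Cmod_harmonic, Rmult_1_r; now apply HM, circle_disc.
Qed.

Lemma cauchy_estimate (f : C -> C) (l : C) (M : R) : holomorphic_on unit_disc f ->
  (forall z, unit_disc z -> Cmod (f z) <= M) -> cderiv f 0 l -> Cmod l <= 2 * M.
Proof.
intros Hf HM Hl; destruct (holomorphic_psum f Hf) as [a [Ha Hm]].
assert (E : l = a 1%nat).
{ rewrite <- (cderiv_C_derive f 0 l Hl); apply cderiv_C_derive.
  apply psum_cderiv_0, near0_disc, Ha. }
(* The radius 1/2 accounts for the factor 2, harmless where only the boundedness of a remainder is
   wanted. *)
specialize (Hm (/ 2) 1%nat ltac:(lra)).
assert (B := Cmod_circle_mean f (/ 2) M 1 Hf ltac:(lra) HM).
rewrite Hm, Cpow_1_r, Cmod_mult, Cmod_R, Rabs_pos_eq in B by lra.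
rewrite E; lra.
Qed.

(** Second order suffices for b_2 and b_3, and jets pass through products and composites without
    multiplying or substituting whole power series. *)
Definition jet (f : C -> C) (a0 a1 a2 : C) : Prop :=
  exists R, bounded0 R /\ near0 (fun z => f z = (a0 + a1 * z + a2 * z ^ 2 + z ^ 3 * R z)%C).

Lemma psum_jet (a : nat -> C) (f : C -> C) : near0 (fun z => psum a z (f z)) ->
  jet f (a 0%nat) (a 1%nat) (a 2%nat).
Proof.
intros H; destruct (psum_expansion a f H 2) as [R [HR E]]; exists R; split; [exact HR|].
apply near0_imp with (2 := E); intros z ->; simpl; ring.
Qed.

(** The coefficients are separated in turn: once the lower ones agree, division by a power of [z]
    exhibits the next difference as O(z). *)
Lemma jet_unique (f g : C -> C) (a0 a1 a2 b0 b1 b2 : C) :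
  jet f a0 a1 a2 -> jet g b0 b1 b2 -> near0 (fun z => z <> 0 -> f z = g z) ->
  a0 = b0 /\ a1 = b1 /\ a2 = b2.
Proof.
intros [R [HR ER]] [Q [HQ EQ]] H.
assert (K := near0_and _ _ H (near0_and _ _ ER EQ)).
assert (BQ : bounded0 (fun z => Q z + - (1) * R z)%C).
{ apply bounded0_plus; [exact HQ|]; apply bounded0_mult; [apply bounded0_const | exact HR]. }
assert (E0 : (a0 - b0)%C = 0).
{ apply near0_constant_zero
    with (fun z => (b1 - a1) + z * ((b2 - a2) + z * (Q z + - (1) * R z)))%C.
  - repeat first [exact BQ | apply bounded0_const | apply bounded0_id
      | apply bounded0_plus | apply bounded0_mult].
  - apply near0_imp with (2 := K); intros z [A [B D]] Hz; specialize (A Hz).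
    rewrite B, D in A; apply Ceq_minus in A; apply Ceq_minus; rewrite <- A; ring. }
apply Ceq_minus in E0; subst b0.
assert (E1 : (a1 - b1)%C = 0).
{ apply near0_constant_zero with (fun z => (b2 - a2) + z * (Q z + - (1) * R z))%C.
  - repeat first [exact BQ | apply bounded0_const | apply bounded0_id
      | apply bounded0_plus | apply bounded0_mult].
  - apply near0_imp with (2 := K); intros z [A [B D]] Hz; specialize (A Hz).
    rewrite B, D in A; apply Ceq_minus in A; apply Ceq_minus.
    replace (a1 - b1 - z * (b2 - a2 + z * (Q z + - (1) * R z)))%C
      with ((a0 + a1 * z + a2 * z ^ 2 + z ^ 3 * R z
        - (a0 + b1 * z + b2 * z ^ 2 + z ^ 3 * Q z)) / z)%C by (field; exact Hz).
    rewrite A; field; exact Hz. }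
apply Ceq_minus in E1; subst b1.
repeat split; apply Ceq_minus.
apply near0_constant_zero with (fun z => (Q z + - (1) * R z))%C; [exact BQ|].
apply near0_imp with (2 := K); intros z [A [B D]] Hz; specialize (A Hz).
rewrite B, D in A; apply Ceq_minus in A; apply Ceq_minus.
replace (a2 - b2 - z * (Q z + - (1) * R z))%C
  with ((a0 + a1 * z + a2 * z ^ 2 + z ^ 3 * R z
    - (a0 + a1 * z + b2 * z ^ 2 + z ^ 3 * Q z)) / z ^ 2)%C by (field; exact Hz).
rewrite A; field; exact Hz.
Qed.

Lemma jet_mult (f g : C -> C) (a0 a1 a2 b0 b1 b2 : C) :
  jet f a0 a1 a2 -> jet g b0 b1 b2 ->
  jet (fun z => f z * g z)%C (a0 * b0) (a0 * b1 + a1 * b0) (a0 * b2 + a1 * b1 + a2 * b0).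
Proof.
intros [R [HR ER]] [Q [HQ EQ]].
exists (fun z => a1 * b2 + a2 * b1 + z * (a2 * b2)
  + (a0 + z * (a1 + z * a2)) * Q z + (b0 + z * (b1 + z * b2)) * R z
  + z * (z * (z * (R z * Q z))))%C; split.
- repeat first [exact HQ | exact HR | apply bounded0_const | apply bounded0_id
    | apply bounded0_plus | apply bounded0_mult].
- apply near0_imp with (2 := near0_and _ _ ER EQ); intros z [-> ->]; ring.
Qed.

Lemma jet_comp (f w : C -> C) (a0 a1 a2 c1 c2 : C) :
  jet f a0 a1 a2 -> jet w 0 c1 c2 ->
  jet (fun z => f (w z)) a0 (a1 * c1) (a1 * c2 + a2 * c1 ^ 2).
Proof.
intros [R [HR ER]] [Q [HQ EQ]].
set (v := fun z => (c1 + z * (c2 + z * Q z))%C).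
assert (Hv : bounded0 v).
{ repeat first [exact HQ | apply bounded0_const | apply bounded0_id
    | apply bounded0_plus | apply bounded0_mult]. }
exists (fun z => a1 * Q z + a2 * ((1 + 1) * c1 * c2 + z * (c2 * c2)
   + z * ((1 + 1) * Q z * (c1 + z * c2)) + z * (z * (z * (Q z * Q z))))
   + v z * (v z * v z) * R (z * v z)%C)%C; split.
- repeat first [exact HQ | exact Hv | apply (bounded0_comp R v HR Hv) | apply bounded0_const
    | apply bounded0_id | apply bounded0_plus | apply bounded0_mult].
- apply near0_imp with (2 := near0_and _ _ EQ (near0_comp _ v ER Hv)).
  intros z [W F].
  assert (E : w z = (z * v z)%C) by (rewrite W; unfold v; ring).
  rewrite E, F; unfold v; ring.
Qed.

(* The remainder of order four has a derivative of order three, by Cauchy's estimate on the disc of radius [|z|] centred at [z]. *)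
Lemma derive_jet (f : C -> C) (a : nat -> C) : holomorphic_on unit_disc f ->
  near0 (fun z => psum a z (f z)) ->
  jet (C_derive f) (a 1%nat) (2 * a 2%nat) (3 * a 3%nat).
Proof.
intros Hf Ha.
destruct (psum_expansion a f Ha 3) as [R [[M [PM HR]] ER]].
set (e := fun z => (f z - (a 0%nat + a 1%nat * z + a 2%nat * (z * z) + a 3%nat * (z * (z * z))))%C).
set (p := fun z => (a 1%nat + 2 * a 2%nat * z + 3 * a 3%nat * (z * z))%C).
assert (He : forall z, unit_disc z -> cderiv e z (C_derive f z - p z)).
{ intros z Dz; unfold e; apply cderiv_minus; [now apply holomorphic_cderiv with unit_disc|].
  eapply cderiv_eq.
  - repeat apply cderiv_plus;
      [apply cderiv_const | apply cderiv_scal, cderiv_id | |];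
      apply cderiv_scal.
    + apply (cderiv_mult (fun w => w) (fun w => w)); apply cderiv_id.
    + apply (cderiv_mult (fun w => w) (fun w => w * w)%C); [apply cderiv_id|].
      apply (cderiv_mult (fun w => w) (fun w => w)); apply cderiv_id.
  - unfold p; ring. }
destruct (near0_and _ _ HR ER) as [d [Hd H]].
assert (He4 : forall z, Cmod z < d -> Cmod (e z) <= M * Cmod z ^ 4).
{ intros z Hz; destruct (H z Hz) as [H1 H2].
  replace (e z) with (R z * z ^ 4)%C by (unfold e; rewrite H2; simpl; ring).
  rewrite Cmod_mult, Cmod_pow; apply Rmult_le_compat_r; [apply pow_le, Cmod_ge_0 | exact H1]. }
(* For |z| < d' the disc of radius |z| about [z] lies in |v| < 2 d', inside both the unit disc and
   the range of [He4]. *)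
set (d' := Rmin d 1 / 2).
assert (Pd : 0 < d') by (assert (X := Rmin_pos d 1 Hd Rlt_0_1); unfold d'; lra).
assert (d1 : 2 * d' <= d) by (unfold d'; assert (X := Rmin_l d 1); lra).
assert (d2 : 2 * d' <= 1) by (unfold d'; assert (X := Rmin_r d 1); lra).
(* The constant is 2 * 2^4: points of that disc have modulus below 2 |z|, and [cauchy_estimate],
   applied after rescaling to the unit disc, contributes the 2. *)
assert (est : forall z, Cmod z < d' -> z <> 0 ->
  Cmod (C_derive f z - p z) <= 32 * M * Cmod z ^ 3).
{ intros z Hz zn; assert (Pz := proj1 (Cmod_gt_0 z) zn).
  set (rho := Cmod z) in *.
  set (F := fun w => e (z + w * RtoC rho)%C).
  assert (in2 : forall w, unit_disc w -> Cmod (z + w * RtoC rho) < 2 * rho).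
  { intros w Dw; apply Rle_lt_trans with (1 := Cmod_triangle _ _).
    rewrite Cmod_mult, Cmod_R, Rabs_pos_eq by lra; fold rho.
    unfold unit_disc in Dw; nra. }
  assert (HF : forall w, unit_disc w ->
    cderiv F w ((C_derive f (z + w * RtoC rho) - p (z + w * RtoC rho)) * RtoC rho)%C).
  { intros w Dw; apply (cderiv_comp e (fun w => z + w * RtoC rho)%C).
    - apply He; specialize (in2 w Dw); unfold unit_disc; lra.
    - apply cderiv_affine. }
  assert (FB : forall w, unit_disc w -> Cmod (F w) <= 16 * M * rho ^ 4).
  { intros w Dw; specialize (in2 w Dw).
    apply Rle_trans with (1 := He4 (z + w * RtoC rho)%C ltac:(lra)).
    replace (16 * M * rho ^ 4) with (M * (2 * rho) ^ 4) by ring.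
    apply Rmult_le_compat_l; [exact PM|]; apply pow_incr; split; [apply Cmod_ge_0 | lra]. }
  assert (C0 := cauchy_estimate F _ _ (fun w Dw => cderiv_ex F w _ (HF w Dw)) FB
    (HF 0%C ltac:(unfold unit_disc; rewrite Cmod_0; lra))).
  replace (z + 0 * RtoC rho)%C with z in C0 by ring.
  rewrite Cmod_mult, Cmod_R, (Rabs_pos_eq rho) in C0 by lra.
  apply Rmult_le_reg_r with rho; [exact Pz|].
  apply Rle_trans with (1 := C0); right; ring. }
exists (fun z => if Ceq_dec z 0 then RtoC 0 else ((C_derive f z - p z) / z ^ 3)%C); split.
- exists (32 * M); split; [lra|]; exists d'; split; [exact Pd|]; intros z Hz.
  destruct (Ceq_dec z 0) as [E|E]; [rewrite Cmod_0; lra|].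
  assert (Pz := proj1 (Cmod_gt_0 z) E).
  rewrite Cmod_div, Cmod_pow by now apply Cpow_nz.
  apply Rle_div_l; [now apply pow_lt | now apply est].
- exists d'; split; [exact Pd|]; intros z Hz; destruct (Ceq_dec z 0) as [->|E].
  + rewrite (cderiv_C_derive f 0 (a 1%nat)) by now apply psum_cderiv_0.
    ring.
  + unfold p; field; exact E.
Qed.

(** * Coefficient estimates *)

Lemma harmonic_2 (t : C) : harmonic 2 t = (harmonic 1 t * harmonic 1 t)%C.
Proof.
unfold harmonic; rewrite <- Cexp_plus; f_equal; simpl INR.
rewrite RtoC_plus; ring.
Qed.

Lemma Cmod_sqr_plus (x y : C) :
  Cmod (x + y) ^ 2 = Cmod x ^ 2 + Cmod y ^ 2 + 2 * Re (Cconj y * x).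
Proof.
rewrite !Cmod2_alt; destruct x as [a b]; destruct y as [u v].
unfold Cconj; simpl; ring.
Qed.

Lemma RInt_kernel (beta : C) :
  is_RInt (fun t => Cmod (harmonic 1 (RtoC t) + beta) ^ 2) 0 (2 * PI)
    (2 * PI * (1 + Cmod beta ^ 2)).
Proof.
assert (P := PI_RGT_0).
(* The squared modulus is the real part of [F], and [harmonic 1] has mean zero. *)
set (F := fun t => (RtoC (1 + Cmod beta ^ 2) + 2 * Cconj beta * harmonic 1 t)%C).
assert (Ch : cont_on (fun t => 2 * Cconj beta * harmonic 1 t)%C 0 (2 * PI)).
{ intros t _; apply ccont_mult; [apply ccont_const | apply ccont_harmonic]. }
assert (CF : cont_on F 0 (2 * PI)).
{ intros t Ht; apply ccont_plus; [apply ccont_const | now apply Ch]. }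
assert (H := rint_correct F 0 (2 * PI) ltac:(lra) CF).
assert (E : rint F 0 (2 * PI) = RtoC (2 * PI * (1 + Cmod beta ^ 2))).
{ unfold F; rewrite (rint_plus (fun _ => RtoC (1 + Cmod beta ^ 2)));
    [| lra | intros t _; apply ccont_const | exact Ch].
  rewrite rint_scal by (lra || (intros t _; apply ccont_harmonic)).
  rewrite rint_const_2PI, (rint_harmonic 0), (RtoC_mult (2 * PI)); ring. }
rewrite E in H.
apply (is_RInt_fct_extend_fst (U := R_NormedModule) (V := R_NormedModule)) in H.
apply (is_RInt_ext (V := R_NormedModule)) with (2 := H); intros t _.
rewrite Cmod_sqr_plus, Cmod_harmonic.
change (Re (F t) = 1 ^ 2 + Cmod beta ^ 2 + 2 * Re (Cconj beta * harmonic 1 t)).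
unfold F; rewrite <- Cmult_assoc, re_plus, re_scal_l, re_RtoC; ring.
Qed.

(* Integrating [w] against the square of [harmonic 1 + beta], whose modulus has mean [1 + |beta|^2]. *)
Lemma schwarz_functional (w : C -> C) (c : nat -> C) (beta : C) :
  holomorphic_on unit_disc w -> (forall z, unit_disc z -> Cmod (w z) <= 1) ->
  (forall r n, 0 < r < 1 -> circle_mean w r n = (c n * RtoC r ^ n)%C) -> c 0%nat = 0 ->
  Cmod (c 2%nat + 2 * beta * c 1%nat) <= 1 + Cmod beta ^ 2.
Proof.
intros Hw H1 Hc c0; assert (P := PI_RGT_0).
assert (main : forall r, 0 < r < 1 ->
  Cmod (c 2%nat * RtoC r ^ 2 + 2 * beta * (c 1%nat * RtoC r)) <= 1 + Cmod beta ^ 2).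
{ intros r Hr.
  set (W := fun n t => (w (circle r t) * harmonic n t)%C).
  assert (CW : forall n, cont_on (W n) 0 (2 * PI)).
  { intros n t _; apply ccont_mult; [apply ccont_on_circle; auto; lra | apply ccont_harmonic]. }
  assert (RW : forall n, rint (W n) 0 (2 * PI) = (RtoC (2 * PI) * (c n * RtoC r ^ n))%C).
  { intros n; rewrite <- (Hc r n Hr); unfold circle_mean, W; field; apply two_PI_neq_0. }
  (* This is [w] times the square of [harmonic 1 t + beta], expanded; the last term integrates to a
     multiple of [c 0], which is 0. *)
  set (F := fun t => (W 2%nat t + (2 * beta * W 1%nat t + beta * beta * W 0%nat t))%C).
  assert (Cs : forall a n, cont_on (fun t => a * W n t)%C 0 (2 * PI)).
  { intros a n t Ht; apply ccont_mult; [apply ccont_const | now apply CW]. }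
  assert (Cp : cont_on (fun t => 2 * beta * W 1%nat t + beta * beta * W 0%nat t)%C 0 (2 * PI)).
  { intros t Ht; apply (ccont_plus (fun t => 2 * beta * W 1%nat t)%C); now apply Cs. }
  assert (E : rint F 0 (2 * PI)
    = (RtoC (2 * PI) * (c 2%nat * RtoC r ^ 2 + 2 * beta * (c 1%nat * RtoC r)))%C).
  { unfold F; rewrite (rint_plus (W 2%nat)) by (lra || auto).
    rewrite (rint_plus (fun t => 2 * beta * W 1%nat t)%C) by (lra || apply Cs).
    rewrite !rint_scal by (lra || auto); rewrite !RW, c0; simpl; ring. }
  apply Rmult_le_reg_l with (2 * PI); [lra|].
  rewrite <- (Rabs_pos_eq (2 * PI)) at 1 by lra; rewrite <- Cmod_R, <- Cmod_mult, <- E.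
  apply Cmod_rint_le with (fun t => Cmod (harmonic 1 (RtoC t) + beta) ^ 2);
    [lra | | | apply RInt_kernel].
  - intros t Ht; apply ccont_plus; [now apply CW | now apply Cp].
  - intros t _; unfold F, W; rewrite harmonic_0, harmonic_2.
    replace (_ + _)%C
      with (w (circle r t) * ((harmonic 1 t + beta) * (harmonic 1 t + beta)))%C by ring.
    rewrite !Cmod_mult; rewrite <- (Rmult_1_l (_ ^ 2)); simpl pow.
    rewrite Rmult_1_r; apply Rmult_le_compat_r; [apply Rmult_le_pos; apply Cmod_ge_0|].
    apply H1, circle_disc; lra. }
apply le_epsilon; intros eps He.
(* The passage r -> 1 is made explicit with r = 1 - s: as 1 - r^2 <= 2 s, the left-hand side changes
   by at most s K. *)
set (K := 2 * Cmod (c 2%nat) + Cmod (2 * beta * c 1%nat) + 1).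
assert (P2 := Cmod_ge_0 (c 2%nat)); assert (P1 := Cmod_ge_0 (2 * beta * c 1%nat)).
set (s := Rmin (/ 2) (eps / K)).
assert (Hs : 0 < s <= / 2).
{ unfold s; split; [apply Rmin_pos; [lra|]; apply Rdiv_lt_0_compat; unfold K; lra | apply Rmin_l]. }
assert (HK : s * K <= eps) by (apply Rle_div_r; [unfold K; lra | apply Rmin_r]).
specialize (main (1 - s) ltac:(lra)).
replace (c 2%nat + 2 * beta * c 1%nat)%C with
  ((c 2%nat * RtoC (1 - s) ^ 2 + 2 * beta * (c 1%nat * RtoC (1 - s)))
   + RtoC (s * (2 - s)) * c 2%nat + RtoC s * (2 * beta * c 1%nat))%C
  by (rewrite RtoC_mult, !RtoC_minus; ring).
apply Rle_trans with (1 := Cmod_triangle3 _ _ _).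
rewrite (Cmod_mult (RtoC (s * (2 - s)))), (Cmod_mult (RtoC s)), !Cmod_R.
rewrite !Rabs_pos_eq by nra.
unfold K in HK.
assert (s * (2 - s) * Cmod (c 2%nat) <= s * 2 * Cmod (c 2%nat))
  by (apply Rmult_le_compat_r; nra).
lra.
Qed.

(** For |beta| = |c_1| and beta c_1 aligned with c_2, [schwarz_functional] reads |c_2| + 2 |c_1|^2
    <= 1 + |c_1|^2. If c_2 = 0 no alignment is called for and beta is the conjugate of c_1. *)
Lemma schwarz_coefficients (w : C -> C) (c : nat -> C) :
  holomorphic_on unit_disc w -> (forall z, unit_disc z -> Cmod (w z) <= 1) ->
  (forall r n, 0 < r < 1 -> circle_mean w r n = (c n * RtoC r ^ n)%C) -> c 0%nat = 0 ->
  Cmod (c 2%nat) + Cmod (c 1%nat) ^ 2 <= 1.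
Proof.
intros Hw H1 Hc c0.
assert (H := fun beta => schwarz_functional w c beta Hw H1 Hc c0).
set (x := c 1%nat) in *; set (y := c 2%nat) in *.
assert (Px := Cmod_ge_0 x).
destruct (Ceq_dec y 0) as [E|E].
- specialize (H (Cconj x)); rewrite E, Cmod_0 in *.
  replace (0 + 2 * Cconj x * x)%C with (2 * (x * Cconj x))%C in H by ring.
  rewrite !Cmod_mult, Cmod_conj, Cmod_R, Rabs_pos_eq in H by lra; nra.
- assert (Py := proj1 (Cmod_gt_0 y) E).
  assert (ny : RtoC (Cmod y) <> 0) by (intros F; apply RtoC_inj in F; lra).
  (* [beta] gives [2 beta x] the argument of [y] *)
  specialize (H (Cconj x * (y / RtoC (Cmod y)))%C).
  replace (y + 2 * (Cconj x * (y / RtoC (Cmod y))) * x)%C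
    with (y * RtoC (1 + 2 * Cmod x ^ 2 / Cmod y))%C in H.
  2: { rewrite RtoC_plus, RtoC_div, RtoC_mult, Cmod2_conj by lra; field; exact ny. }
  assert (Q : 0 <= 2 * Cmod x ^ 2 / Cmod y) by (apply Rdiv_le_0_compat; nra).
  rewrite !Cmod_mult, Cmod_div, Cmod_conj, !Cmod_R in H by exact ny.
  rewrite !Rabs_pos_eq in H by lra.
  replace (Cmod y * (1 + 2 * Cmod x ^ 2 / Cmod y)) with (Cmod y + 2 * Cmod x ^ 2) in H
    by (field; lra).
  replace (Cmod x * (Cmod y / Cmod y)) with (Cmod x) in H by (field; lra).
  lra.
Qed.

Lemma quot_0_jet (g : C -> C) (b : nat -> C) : b 0%nat = 0 ->
  near0 (fun z => psum b z (g z)) ->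
  jet (quot g 0 (b 1%nat)) (b 1%nat) (b 2%nat) (b 3%nat).
Proof.
intros b0 H; destruct (psum_expansion b g H 3) as [R [HR E]].
destruct (psum_cderiv_0 b g H) as [g0 _]; rewrite b0 in g0.
exists R; split; [exact HR|]; apply near0_imp with (2 := E); intros z Hz.
unfold quot; destruct (Ceq_dec z 0) as [->|n]; [ring|].
rewrite g0, Hz; cbn [partial_sum]; rewrite b0; field; exact n.
Qed.

(** At 0, where [disc_quot] gives only continuity, the Taylor series shows that the quotient is a_1
    + a_2 z + O(z^2). *)
Lemma removable_quot_holomorphic (f : C -> C) : holomorphic_on unit_disc f -> f 0 = 0 ->
  holomorphic_on unit_disc (quot f 0 (C_derive f 0)).
Proof.
intros Hf f0 z Dz; destruct (Ceq_dec z 0) as [->|n].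
- destruct (holomorphic_psum f Hf) as [a [Ha _]].
  assert (H := near0_disc _ Ha).
  destruct (psum_cderiv_0 a f H) as [A0 A1]; rewrite f0 in A0.
  rewrite (cderiv_C_derive _ _ _ A1).
  destruct (quot_0_jet f a (eq_sym A0) H) as [R [HR E]].
  apply cderiv_ex with (a 2%nat).
  apply first_order_cderiv with (R := fun z => (a 3%nat + z * R z)%C) (a0 := a 1%nat).
  + repeat first [exact HR | apply bounded0_const | apply bounded0_id
      | apply bounded0_plus | apply bounded0_mult].
  + apply near0_imp with (2 := E); intros v ->; ring.
- destruct (quot_cderiv f 0 (C_derive f 0) z _ n (holomorphic_cderiv _ f z Hf Dz)) as [q Hq].
  now apply cderiv_ex with q.
Qed.

(* Coefficients of [z g' = g (Phi o w)]. *)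
Lemma coefficient_relations (g Phi w : C -> C) (b : nat -> C) (p1 p2 c1 c2 : C) :
  holomorphic_on unit_disc g -> near0 (fun z => psum b z (g z)) ->
  b 0%nat = 0 -> b 1%nat = 1 -> jet Phi 1 p1 p2 -> jet w 0 c1 c2 ->
  near0 (fun z => z <> 0 -> C_derive g z = (quot g 0 1 z * Phi (w z))%C) ->
  b 2%nat = (p1 * c1)%C /\ (2 * b 3%nat)%C = (p1 * c2 + p2 * c1 ^ 2 + p1 * c1 * b 2%nat)%C.
Proof.
intros Hg Hb b0 b1 JP Jw H.
assert (J1 := derive_jet g b Hg Hb).
assert (J2 := quot_0_jet g b b0 Hb); rewrite b1 in J1, J2.
(* The equation is used after division by [z], as g' = (g/z) (Phi o w), so that second-order jets
   already reach b_3. *)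
assert (J := jet_mult _ _ _ _ _ _ _ _ J2 (jet_comp _ _ _ _ _ _ _ JP Jw)).
destruct (jet_unique _ _ _ _ _ _ _ _ J1 J H) as [_ [E2 E3]].
apply Ceq_minus in E2; apply Ceq_minus in E3; split; apply Ceq_minus.
- rewrite <- E2; ring.
- rewrite <- E3; ring.
Qed.

Lemma Phi_jet (Phi : C -> C) (B1 B2 : R) : holomorphic_on unit_disc Phi ->
  Phi (RtoC 0) = RtoC 1 -> C_derive Phi (RtoC 0) = RtoC B1 ->
  C_derive (C_derive Phi) (RtoC 0) = RtoC B2 -> jet Phi 1 (RtoC B1) (RtoC (B2 / 2)).
Proof.
intros HP P0 P1 P2; destruct (holomorphic_psum Phi HP) as [a [Ha _]].
assert (H := near0_disc _ Ha).
destruct (psum_cderiv_0 a Phi H) as [A0 A1].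
assert (J := psum_jet a Phi H).
rewrite P0 in A0; rewrite <- A0 in J.
rewrite <- (cderiv_C_derive _ _ _ A1), P1 in J.
destruct (derive_jet Phi a HP H) as [R [HR E]].
assert (A2 : C_derive (C_derive Phi) 0 = (2 * a 2%nat)%C).
{ apply cderiv_C_derive.
  apply first_order_cderiv with (R := fun z => (3 * a 3%nat + z * R z)%C) (a0 := a 1%nat).
  - repeat first [exact HR | apply bounded0_const | apply bounded0_id
      | apply bounded0_plus | apply bounded0_mult].
  - apply near0_imp with (2 := E); intros v ->; ring. }
assert (two : RtoC 2 <> 0) by (intros X; apply RtoC_inj in X; lra).
replace (RtoC (B2 / 2)) with (a 2%nat); [exact J|].
rewrite RtoC_div, <- P2, A2 by lra; field; exact two.
Qed.

(** * The upper bound for the determinant *)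

Lemma det_bound (B1 B2 : R) (b2 b3 c1 c2 : C) : 0 < B1 ->
  2 * B1 - 2 * B1 ^ 2 <= B2 -> B2 <= 6 * B1 ^ 2 - 2 * B1 ->
  Cmod c2 + Cmod c1 ^ 2 <= 1 -> b2 = (RtoC B1 * c1)%C ->
  (2 * b3)%C = (RtoC B1 * c2 + RtoC (B2 / 2) * c1 ^ 2 + RtoC B1 * c1 * b2)%C ->
  Cmod (2 * b2 ^ 2 * b3 - 2 * b2 ^ 2 - b3 ^ 2 + 1) <=
  1 + 2 * B1 ^ 2 + B1 ^ 2 / 4 * (3 * B1 - B2 / (2 * B1)) * (B2 / (2 * B1) + B1).
Proof.
intros PB L U Hc -> E3.
set (lam := B2 / (2 * B1) + B1); set (mu := 3 * B1 - B2 / (2 * B1)).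
assert (Hl : 1 <= lam).
{ unfold lam; apply Rplus_le_reg_r with (- B1); ring_simplify.
  apply Rle_div_r; [lra|]; nra. }
assert (Hm : 1 <= mu).
{ unfold mu; assert (B2 / (2 * B1) <= 3 * B1 - 1) by (apply Rle_div_l; [lra|]; nra); lra. }
assert (two : RtoC 2 <> 0) by (intros X; apply RtoC_inj in X; lra).
assert (nB : RtoC B1 <> 0) by (intros X; apply RtoC_inj in X; lra).
assert (X3 : b3 = (RtoC (B1 / 2) * (c2 + RtoC lam * c1 ^ 2))%C).
{ replace b3 with (2 * b3 / 2)%C by (field; exact two); rewrite E3.
  unfold lam; rewrite RtoC_plus, !RtoC_div, RtoC_mult by lra; field; assumption. }
assert (Y3 : (2 * (RtoC B1 * c1) ^ 2 - b3)%C
  = (RtoC (B1 / 2) * (RtoC mu * c1 ^ 2 - c2))%C).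
{ rewrite X3; unfold lam, mu.
  rewrite RtoC_plus, RtoC_minus, !RtoC_div, !RtoC_mult by lra; field; assumption. }
replace (2 * (RtoC B1 * c1) ^ 2 * b3 - 2 * (RtoC B1 * c1) ^ 2 - b3 ^ 2 + 1)%C
  with (1 - 2 * (RtoC B1 * c1) ^ 2 + b3 * (2 * (RtoC B1 * c1) ^ 2 - b3))%C by ring.
assert (P1 := Cmod_ge_0 c1); assert (P2 := Cmod_ge_0 c2).
assert (S1 : Cmod c1 ^ 2 <= 1) by lra.
assert (S0 : 0 <= Cmod c1 ^ 2) by apply pow2_ge_0.
assert (Z1 : Cmod b3 <= B1 / 2 * lam).
{ rewrite X3, Cmod_mult, Cmod_R, Rabs_pos_eq by lra; apply Rmult_le_compat_l; [lra|].
  (* Since lambda >= 1, |c_2| + lambda |c_1|^2 <= lambda (|c_2| + |c_1|^2) <= lambda; [Z2] uses mu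
     in the same way. *)
  apply Rle_trans with (1 := Cmod_triangle _ _).
  rewrite Cmod_mult, Cmod_pow, Cmod_R, Rabs_pos_eq by lra; nra. }
assert (Z2 : Cmod (2 * (RtoC B1 * c1) ^ 2 - b3) <= B1 / 2 * mu).
{ rewrite Y3, Cmod_mult, Cmod_R, Rabs_pos_eq by lra; apply Rmult_le_compat_l; [lra|].
  apply Rle_trans with (1 := Cmod_minus_le _ _).
  rewrite Cmod_mult, Cmod_pow, Cmod_R, Rabs_pos_eq by lra; nra. }
assert (Z3 : Cmod (2 * (RtoC B1 * c1) ^ 2) <= 2 * B1 ^ 2).
{ rewrite Cmod_mult, Cmod_pow, Cmod_mult, !Cmod_R, !Rabs_pos_eq by lra.
  rewrite Rpow_mult_distr; assert (0 <= B1 ^ 2) by apply pow2_ge_0; nra. }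
apply Rle_trans with (1 := Cmod_triangle _ _); rewrite Cmod_mult.
assert (Z4 := Cmod_minus_le 1 (2 * (RtoC B1 * c1) ^ 2)); rewrite Cmod_1 in Z4.
assert (Z5 : Cmod b3 * Cmod (2 * (RtoC B1 * c1) ^ 2 - b3) <= B1 / 2 * lam * (B1 / 2 * mu)).
{ apply Rmult_le_compat; auto using Cmod_ge_0. }
replace (B1 ^ 2 / 4 * mu * lam) with (B1 / 2 * lam * (B1 / 2 * mu)) by field.
lra.
Qed.

(** The Schwarz function is the inverse [h] of [Phi] applied to z/p(z). Its holomorphy at 0 is the
    delicate point: z/p(z) is rewritten as the inverse of p(z)/z, which has a removable singularity
    there and does not vanish on the disc. *)
Lemma subordination (Phi g : C -> C) (b : nat -> C) (B1 B2 : R) :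
  biholomorphic_onto_image unit_disc Phi -> Phi (RtoC 0) = RtoC 1 ->
  jet Phi 1 (RtoC B1) (RtoC (B2 / 2)) ->
  normalized_expansion g b -> quotient_in_M Phi g ->
  exists c1 c2 : C, Cmod c2 + Cmod c1 ^ 2 <= 1 /\ b 2%nat = (RtoC B1 * c1)%C /\
    (2 * b 3%nat)%C = (RtoC B1 * c2 + RtoC (B2 / 2) * c1 ^ 2 + RtoC B1 * c1 * b 2%nat)%C.
Proof.
intros [_ [_ [h [Hh hP]]]] P0 JP [Hg [b0 [b1 Hb]]] [g'n [Hp [p0 [p1 [pn pim]]]]].
set (p := fun z => (g z / C_derive g z)%C) in *.
change (p 0 = 0) in p0; change (forall z, unit_disc z -> z <> 0 -> p z <> 0) in pn.
assert (Sb : near0 (fun z => psum b z (g z))).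
{ apply near0_disc; intros z Dz; now apply psum_is_pseries, Hb. }
set (w := fun z => h (id_over p z)).
assert (Hw : forall z, unit_disc z -> unit_disc (w z) /\ Phi (w z) = id_over p z).
{ intros z Dz; destruct (pim z Dz) as [u [Du Eu]].
  unfold w; rewrite <- Eu, hP by exact Du; now split. }
assert (w0 : w 0 = 0).
{ unfold w, id_over; destruct (Ceq_dec 0 0) as [_|n]; [|now destruct n].
  rewrite <- P0; apply hP; unfold unit_disc; rewrite Cmod_0; lra. }
(* The equation covers all of C, also points off the disc where [p] may vanish: there both sides are
   0, because [/ 0] evaluates to 0. Hence [cderiv_ext_near] can later be applied without restricting
   to the disc. *)
assert (Eid : forall z, id_over p z = (/ quot p 0 (C_derive p 0) z)%C).
{ intros z; unfold id_over, quot; destruct (Ceq_dec z 0) as [E|E].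
  - rewrite p1; field; exact C1_nz.
  - destruct (Ceq_dec (p z) 0) as [F|F].
    + rewrite F, p0; unfold Cdiv.
      replace (0 - 0)%C with (RtoC 0) by ring; rewrite Cmult_0_l.
      unfold Cinv, RtoC; simpl; unfold Rdiv; rewrite !Rmult_0_l, Ropp_0, Rmult_0_l.
      unfold Cmult; destruct z; simpl; f_equal; ring.
    + rewrite p0; replace (z - 0)%C with z by ring; replace (p z - 0)%C with (p z) by ring.
      field; now split. }
assert (Hol : holomorphic_on unit_disc w).
{ intros z Dz; assert (Hq := removable_quot_holomorphic p Hp p0 z Dz).
  assert (Dq := holomorphic_cderiv _ _ z (removable_quot_holomorphic p Hp p0) Dz).
  assert (qn : quot p 0 (C_derive p 0) z <> 0).
  { unfold quot; destruct (Ceq_dec z 0) as [E|E]; [rewrite p1; exact C1_nz|].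
    rewrite p0; replace (z - 0)%C with z by ring; replace (p z - 0)%C with (p z) by ring.
    intros F; apply (pn z Dz E); replace (p z) with (p z / z * z)%C by (field; exact E).
    rewrite F; ring. }
  assert (I := pim z Dz); rewrite Eid in I.
  assert (Dh := holomorphic_cderiv _ h _ Hh I).
  assert (Dw := cderiv_comp h (fun v => / quot p 0 (C_derive p 0) v)%C z _ _ Dh
    (cderiv_comp (fun v => / v)%C _ z _ _ (cderiv_inv _ qn) Dq)).
  eapply cderiv_ex, cderiv_ext_near with (3 := Dw); [exact Rlt_0_1|].
  intros v _; unfold w; now rewrite Eid. }
destruct (holomorphic_psum w Hol) as [c [Hc Mc]].
destruct (psum_cderiv_0 c w (near0_disc _ Hc)) as [C0 _]; rewrite w0 in C0; symmetry in C0.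
assert (Jw := psum_jet c w (near0_disc _ Hc)); rewrite C0 in Jw.
exists (c 1%nat), (c 2%nat); split.
- apply schwarz_coefficients with w; auto.
  intros z Dz; apply Rlt_le, Hw, Dz.
- apply (coefficient_relations g Phi w b); auto.
  apply near0_disc; intros z Dz zn.
  destruct (Hw z Dz) as [_ ->].
  unfold id_over, quot; destruct (Ceq_dec z 0) as [E|_]; [now destruct zn|].
  assert (g0 : g 0 = 0).
  { destruct (psum_cderiv_0 b g Sb) as [G0 _]; now rewrite G0. }
  assert (pz := pn z Dz zn); assert (dz := g'n z Dz).
  assert (gz : g z <> 0).
  { intros F; apply pz; unfold p; rewrite F; field; exact dz. }
  unfold p; rewrite g0; replace (g z - 0)%C with (g z) by ring.
  replace (z - 0)%C with z by ring; field; repeat split; assumption.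
Qed.

(** * Sharpness: the extremal function *)

Lemma unit_disc_rotate (z : C) : unit_disc z -> unit_disc (Ci * z).
Proof. unfold unit_disc; rewrite Cmod_mult, Cmod_Ci, Rmult_1_l; auto. Qed.

(** Solving z g'/g = Phi(i z) gives g(z) = z exp(K(z) - K(0)) with K' = (Phi(i z) - 1)/z, a
    primitive that [disc_quot] provides. Positivity of Re Phi keeps g' from vanishing, since g' is
    the exponential factor times Phi(i z). *)
Lemma rotated_starlike (Phi : C -> C) : holomorphic_on unit_disc Phi ->
  Phi (RtoC 0) = RtoC 1 -> (forall z, unit_disc z -> 0 < Re (Phi z)) ->
  exists (g : C -> C) (b : nat -> C), normalized_expansion g b /\ quotient_in_M Phi g /\
    forall z, unit_disc z -> z <> 0 -> C_derive g z = (quot g 0 1 z * Phi (Ci * z))%C.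
Proof.
intros HP P0 PR.
set (Psi := fun z => Phi (Ci * z)%C).
assert (D0 : unit_disc 0) by (unfold unit_disc; rewrite Cmod_0; lra).
assert (Psi0 : Psi 0 = 1) by (unfold Psi; rewrite Cmult_0_r; exact P0).
assert (DPsi : forall z, unit_disc z -> cderiv Psi z (C_derive Phi (Ci * z) * (Ci * 1))%C).
{ intros z Dz; apply (cderiv_comp Phi (fun z => Ci * z)%C).
  - apply holomorphic_cderiv with unit_disc; [exact HP | now apply unit_disc_rotate].
  - apply cderiv_scal, cderiv_id. }
assert (HPsi : holomorphic_on unit_disc Psi).
{ intros z Dz; eapply cderiv_ex, DPsi, Dz. }
assert (Psin : forall z, unit_disc z -> Psi z <> 0).
{ intros z Dz E; assert (X := PR _ (unit_disc_rotate z Dz)).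
  fold (Psi z) in X; rewrite E, re_RtoC in X; lra. }
destruct (disc_quot Psi 0 HPsi D0) as [_ [K HK]].
set (e := fun z => Cexp (K z - K 0)).
set (g := fun z => (z * e z)%C).
assert (e0 : e 0 = 1).
{ unfold e; replace (K 0 - K 0)%C with (RtoC 0) by ring; apply Cexp_0. }
assert (en : forall z, e z <> 0) by (intros z; apply Cexp_neq_0).
assert (Dg : forall z, unit_disc z -> cderiv g z (e z * Psi z)%C).
{ intros z Dz; eapply cderiv_eq.
  - apply (cderiv_mult (fun z => z) e); [apply cderiv_id|].
    apply (cderiv_comp Cexp (fun z => K z - K 0)%C); [apply cderiv_Cexp|].
    apply cderiv_minus; [now apply HK | apply cderiv_const].
  - fold (e z); unfold quot; destruct (Ceq_dec z 0) as [->|n].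
    + rewrite Psi0; ring.
    + rewrite Psi0; field; exact n. }
assert (Cg : forall z, unit_disc z -> C_derive g z = (e z * Psi z)%C).
{ intros z Dz; now apply cderiv_C_derive, Dg. }
assert (Hg : holomorphic_on unit_disc g).
{ intros z Dz; eapply cderiv_ex, Dg, Dz. }
assert (g0 : g 0 = 0) by (unfold g; ring).
destruct (holomorphic_psum g Hg) as [b [Hb _]].
destruct (psum_cderiv_0 b g (near0_disc _ Hb)) as [B0 B1].
set (p := fun z => (g z / C_derive g z)%C).
assert (Ep : forall z, unit_disc z -> p z = (z / Psi z)%C).
{ intros z Dz; unfold p; rewrite Cg by exact Dz; unfold g; field.
  split; [now apply Psin | apply en]. }
assert (Dp : forall z, unit_disc z -> cderiv p z
  (1 * / Psi z + z * (- / (Psi z * Psi z) * (C_derive Phi (Ci * z) * (Ci * 1))))%C).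
{ intros z Dz.
  apply cderiv_ext_near with (fun z => z / Psi z)%C (1 - Cmod z).
  - unfold unit_disc in Dz; lra.
  - intros v Hv; symmetry; now apply Ep, unit_disc_near.
  - apply (cderiv_div (fun z => z) Psi); [now apply Psin | apply cderiv_id | now apply DPsi]. }
exists g, b; split; [|split; [split; [|split; [|split; [|split; [|split]]]]|]].
- repeat split.
  + exact Hg.
  + now rewrite <- B0.
  + rewrite <- (cderiv_C_derive _ _ _ B1), Cg, e0, Psi0 by exact D0; ring.
  + intros z Dz; now apply psum_is_pseries, Hb.
- intros z Dz; rewrite Cg by exact Dz; apply Cmult_neq_0; [apply en | now apply Psin].
- intros z Dz; eapply cderiv_ex, Dp, Dz.
- change (p 0 = 0); rewrite (Ep 0 D0), Psi0; field; exact C1_nz.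
- change (C_derive p 0 = 1); rewrite (cderiv_C_derive _ _ _ (Dp 0 D0)), Psi0; field; exact C1_nz.
- intros z Dz zn; change (p z <> 0); rewrite Ep by exact Dz.
  apply Cmult_neq_0; [exact zn|]; intros F.
  apply C1_nz; rewrite <- (Cinv_r (Psi z)), F by (now apply Psin); ring.
- intros z Dz; exists (Ci * z)%C; split; [now apply unit_disc_rotate|].
  change (Psi z = id_over p z); unfold id_over; destruct (Ceq_dec z 0) as [->|n]; [exact Psi0|].
  rewrite Ep by exact Dz; field; split; [now apply Psin | exact n].
- intros z Dz zn; rewrite Cg by exact Dz; fold (Psi z).
  unfold quot; destruct (Ceq_dec z 0) as [E|_]; [now destruct zn|].
  rewrite g0; unfold g; field; exact zn.
Qed.

Lemma det_extremal (B1 B2 : R) (b2 b3 : C) : 0 < B1 ->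
  2 * B1 - 2 * B1 ^ 2 <= B2 -> B2 <= 6 * B1 ^ 2 - 2 * B1 ->
  b2 = (RtoC B1 * Ci)%C ->
  (2 * b3)%C = (RtoC B1 * 0 + RtoC (B2 / 2) * Ci ^ 2 + RtoC B1 * Ci * b2)%C ->
  Cmod (2 * b2 ^ 2 * b3 - 2 * b2 ^ 2 - b3 ^ 2 + 1) =
  1 + 2 * B1 ^ 2 + B1 ^ 2 / 4 * (3 * B1 - B2 / (2 * B1)) * (B2 / (2 * B1) + B1).
Proof.
intros PB L U -> E3.
assert (two : RtoC 2 <> 0) by (intros X; apply RtoC_inj in X; lra).
assert (I : (Ci * Ci)%C = (- (1))%C).
{ unfold Ci, Cmult, RtoC, Copp; simpl; f_equal; ring. }
assert (X3 : b3 = RtoC (- (B2 / 4 + B1 ^ 2 / 2))).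
{ replace b3 with (2 * b3 / 2)%C by (field; exact two); rewrite E3.
  replace (RtoC B1 * 0 + RtoC (B2 / 2) * Ci ^ 2 + RtoC B1 * Ci * (RtoC B1 * Ci))%C
    with ((Ci * Ci) * (RtoC (B2 / 2) + RtoC B1 * RtoC B1))%C by ring.
  rewrite I, <- RtoC_mult, <- RtoC_plus, <- RtoC_opp, <- RtoC_mult, <- RtoC_div by lra.
  f_equal; field. }
assert (X2 : ((RtoC B1 * Ci) ^ 2)%C = RtoC (- B1 ^ 2)).
{ replace ((RtoC B1 * Ci) ^ 2)%C with ((Ci * Ci) * (RtoC B1 * RtoC B1))%C by ring.
  rewrite I, <- RtoC_mult, <- RtoC_opp, <- RtoC_mult; f_equal; ring. }
rewrite X2, X3.
assert (D : 1 + 2 * B1 ^ 2 + B1 ^ 2 / 4 * (3 * B1 - B2 / (2 * B1)) * (B2 / (2 * B1) + B1)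
  = 1 + 2 * B1 ^ 2 + (3 * B1 ^ 2 - B2 / 2) * (B2 / 2 + B1 ^ 2) / 4) by (field; lra).
rewrite D.
rewrite <- RtoC_pow, <- !RtoC_mult, <- !RtoC_minus, <- RtoC_plus, Cmod_R.
rewrite Rabs_pos_eq; [field|].
assert (0 <= (3 * B1 ^ 2 - B2 / 2) * (B2 / 2 + B1 ^ 2)) by (apply Rmult_le_pos; lra).
nra.
Qed.

(* B1 and B2 are the (real) numbers Phi'(0) and Phi''(0). *)
Theorem theorem2p2 (Phi : C -> C) (B1 B2 : R)
  (Phi_biholo : biholomorphic_onto_image unit_disc Phi)
  (Phi_0 : Phi (RtoC 0) = RtoC 1)
  (Phi_Re : forall z : C, unit_disc z -> 0 < Re (Phi z))
  (Phi_d1 : C_derive Phi (RtoC 0) = RtoC B1)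
  (B1_pos : 0 < B1)
  (Phi_d2 : C_derive (C_derive Phi) (RtoC 0) = RtoC B2)
  (B2_lower : 2 * B1 - 2 * B1 ^ 2 <= B2)
  (B2_upper : B2 <= 6 * B1 ^ 2 - 2 * B1) :
  let bound :=
    1 + 2 * B1 ^ 2
    + B1 ^ 2 / 4 * (3 * B1 - B2 / (2 * B1)) * (B2 / (2 * B1) + B1) in
  (forall (g : C -> C) (b : nat -> C),
     normalized_expansion g b ->
     quotient_in_M Phi g ->
     Cmod (det3 (Toeplitz 3 1 b)) <= bound) /\
  (exists (g : C -> C) (b : nat -> C),
     normalized_expansion g b /\
     quotient_in_M Phi g /\
     Cmod (det3 (Toeplitz 3 1 b)) = bound).
Proof.
intros bound.
assert (J := Phi_jet Phi B1 B2 (proj1 Phi_biholo) Phi_0 Phi_d1 Phi_d2).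
split.
- intros g b Hb Hg.
  destruct (subordination Phi g b B1 B2 Phi_biholo Phi_0 J Hb Hg) as [c1 [c2 [Hc [E2 E3]]]].
  rewrite det3_Toeplitz by apply Hb.
  now apply det_bound with c1 c2.
- destruct (rotated_starlike Phi (proj1 Phi_biholo) Phi_0 Phi_Re) as [g [b [Hb [Hg HC]]]].
  exists g, b; split; [exact Hb | split; [exact Hg|]].
  rewrite det3_Toeplitz by apply Hb.
  destruct Hb as [Hol [b0 [b1 Hs]]].
  destruct (coefficient_relations g Phi (fun z => Ci * z)%C b (RtoC B1) (RtoC (B2 / 2)) Ci 0)
    as [E2 E3]; auto.
  + apply near0_disc; intros z Dz; now apply psum_is_pseries, Hs.
  + exists (fun _ => RtoC 0); split; [apply bounded0_const|].
    apply near0_disc; intros z _; ring.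
  + apply near0_disc; exact HC.
  + now apply det_extremal.
Qed.
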